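(* Let $\epsilon\in(0,1)$ and let $\mathbf A\in\mathbb{R}^{n\times n}$ be a symmetric bounded entry matrix with eigenvalues $\lambda_1(\mathbf A)\ge\cdots\ge\lambda_n(\mathbf A)$ such that either $\mathbf A$ is positive semidefinite (i.e. $\lambda_n(\mathbf A)\ge0$) or $\lambda_n(\mathbf A)\le-\epsilon\cdot\max(n,\|\mathbf A\|_1)$. There exists a deterministic algorithm that distinguishes between these two cases by reading $\widetilde O(n/\epsilon^4)$ entries of $\mathbf A$ and which runs in time $\widetilde O(n^2/\epsilon^5)$.
   Context: A matrix has bounded entries if all its entries have absolute value at most $1$; $\|\mathbf A\|_1$ is the nuclear norm. The running time is stated assuming a fixed deterministic sparse sampling matrix (depending only on $n$ and $\epsilon$, e.g. a scaled Ramanujan expander adjacency matrix) has already been constructed. $\widetilde O$ hides polylogarithmic factors in $n$ and $1/\epsilon$. *)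

(* Defs.v *)
From mathcomp Require Import all_boot all_order all_algebra.
From mathcomp Require Import boolp classical_sets reals exp.

Set Implicit Arguments.
Unset Strict Implicit.
Unset Printing Implicit Defensive.

Import Order.TTheory GRing.Theory Num.Theory.
Local Open Scope ring_scope.

(* The eigenvalues of A with multiplicity, in nonincreasing order, so that
   (eigvals A)`_i is lambda_(i+1)(A) and (eigvals A)`_n.-1 is lambda_n(A).
   It is junk ([::]) only if the characteristic polynomial does not split over
   R, which never happens for a symmetric A. *)
Definition eigvals (R : realType) (n : nat) (A : 'M[R]_n) : seq R :=
  xget [::] [set s : seq R | sorted >=%R s /\
                             char_poly A = \prod_(x <- s) ('X - x%:P)]%classic.

(* Sum of the singular values, i.e. of the square roots of the eigenvalues of
   A^T A. *)
Definition nuclear_norm (R : realType) (n : nat) (A : 'M[R]_n) : R :=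
  \sum_(x <- eigvals (A^T *m A)) Num.sqrt x.

Definition bounded_entries (R : realType) (n : nat) (A : 'M[R]_n) : Prop :=
  forall i j, `|A i j| <= 1.

(* Real RAM with query access to a matrix. There are integer scalars, real
   scalars, and unbounded integer and real arrays, each family named by a
   natural number; a program mentions finitely many of them, so this is the
   usual real RAM with indirect addressing. Integers support only addition,
   truncated subtraction and comparison; reals support exact field operations
   and comparison, without rounding to integers. The only constants are natural
   numbers, so a program does not depend on the field R. *)

Inductive test : Type :=
| TNlt (x y : nat)
| TRlt (r s : nat).

Inductive com : Type :=
| Skip
| NConst (x k : nat)
| NAdd (x y z : nat)
| NSub (x y z : nat)
| NLoad (x a i : nat)
| NStore (a i x : nat)
| ROfNat (r x : nat)
| RAdd (r s t : nat)
| RSub (r s t : nat)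
| RMul (r s t : nat)
| RDiv (r s t : nat)
| RLoad (r a i : nat)
| RStore (a i r : nat)
| Query (r x y : nat)
| Seq (c1 c2 : com)
| If (b : test) (c1 c2 : com)
| While (b : test) (c : com).

Record state (R : Type) := State {
  nvar : nat -> nat;
  rvar : nat -> R;
  narr : nat -> nat -> nat;
  rarr : nat -> nat -> R
}.

Definition upd (T : Type) (f : nat -> T) (k : nat) (v : T) : nat -> T :=
  fun j => if j == k then v else f j.

Definition set_nvar (R : Type) (s : state R) x v :=
  State (upd (nvar s) x v) (rvar s) (narr s) (rarr s).
Definition set_rvar (R : Type) (s : state R) r v :=
  State (nvar s) (upd (rvar s) r v) (narr s) (rarr s).
Definition set_narr (R : Type) (s : state R) a i v :=
  State (nvar s) (rvar s) (upd (narr s) a (upd (narr s a) i v)) (rarr s).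
Definition set_rarr (R : Type) (s : state R) a i v :=
  State (nvar s) (rvar s) (narr s) (upd (rarr s) a (upd (rarr s a) i v)).

Definition eval_test (R : realType) (b : test) (s : state R) : bool :=
  match b with
  | TNlt x y => (nvar s x < nvar s y)%N
  | TRlt r t => rvar s r < rvar s t
  end.

(* Answer to a query; it is 0 outside the matrix. *)
Definition entry (R : realType) (n : nat) (A : 'M[R]_n) (i j : nat) : R :=
  match insub i, insub j with
  | Some i', Some j' => A i' j'
  | _, _ => 0
  end.

(* exec A c s s' q t: run with query access to A, the program c halts from s in
   s' after q matrix reads (repetitions counted) and t unit-cost steps. *)
Inductive exec (R : realType) (n : nat) (A : 'M[R]_n) :
  com -> state R -> state R -> nat -> nat -> Prop :=
| ESkip s : exec A Skip s s 0 1
| ENConst s x k : exec A (NConst x k) s (set_nvar s x k) 0 1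
| ENAdd s x y z :
    exec A (NAdd x y z) s (set_nvar s x (nvar s y + nvar s z)%N) 0 1
| ENSub s x y z :
    exec A (NSub x y z) s (set_nvar s x (nvar s y - nvar s z)%N) 0 1
| ENLoad s x a i :
    exec A (NLoad x a i) s (set_nvar s x (narr s a (nvar s i))) 0 1
| ENStore s a i x :
    exec A (NStore a i x) s (set_narr s a (nvar s i) (nvar s x)) 0 1
| EROfNat s r x : exec A (ROfNat r x) s (set_rvar s r (nvar s x)%:R) 0 1
| ERAdd s r u v :
    exec A (RAdd r u v) s (set_rvar s r (rvar s u + rvar s v)) 0 1
| ERSub s r u v :
    exec A (RSub r u v) s (set_rvar s r (rvar s u - rvar s v)) 0 1
| ERMul s r u v :
    exec A (RMul r u v) s (set_rvar s r (rvar s u * rvar s v)) 0 1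
| ERDiv s r u v :
    exec A (RDiv r u v) s (set_rvar s r (rvar s u / rvar s v)) 0 1
| ERLoad s r a i :
    exec A (RLoad r a i) s (set_rvar s r (rarr s a (nvar s i))) 0 1
| ERStore s a i r :
    exec A (RStore a i r) s (set_rarr s a (nvar s i) (rvar s r)) 0 1
| EQuery s r x y :
    exec A (Query r x y) s (set_rvar s r (entry A (nvar s x) (nvar s y))) 1 1
| ESeq c1 c2 s s1 s2 q1 q2 t1 t2 :
    exec A c1 s s1 q1 t1 -> exec A c2 s1 s2 q2 t2 ->
    exec A (Seq c1 c2) s s2 (q1 + q2) (t1 + t2)
| EIfTrue b c1 c2 s s' q t :
    eval_test b s -> exec A c1 s s' q t -> exec A (If b c1 c2) s s' q t.+1
| EIfFalse b c1 c2 s s' q t :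
    ~~ eval_test b s -> exec A c2 s s' q t -> exec A (If b c1 c2) s s' q t.+1
| EWhileFalse b c s :
    ~~ eval_test b s -> exec A (While b c) s s 0 1
| EWhileTrue b c s s1 s2 q1 q2 t1 t2 :
    eval_test b s -> exec A c s s1 q1 t1 ->
    exec A (While b c) s1 s2 q2 t2 ->
    exec A (While b c) s s2 (q1 + q2) (t1 + t2).+1.

Definition supp (R : realType) (n : nat) (S : 'M[R]_n) : seq ('I_n * 'I_n) :=
  [seq p <- enum {: 'I_n * 'I_n} | S p.1 p.2 != 0].

(* Initial memory, which knows nothing about the input matrix: n and eps, and
   the sampling matrix S in sparse coordinate form, i.e. its number of nonzero
   entries (integer scalar 1), their row and column indices (integer arrays 0
   and 1) and their values (real array 0). Everything else is 0. *)
Definition init_state (R : realType) (n : nat) (eps : R) (S : 'M[R]_n) :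
    state R :=
  State
    (fun x => match x with 0%N => n | 1%N => size (supp S) | _ => 0%N end)
    (fun r => match r with 0%N => eps | _ => 0 end)
    (fun a k => match a with
                | 0%N => nth 0%N [seq val p.1 | p <- supp S] k
                | 1%N => nth 0%N [seq val p.2 | p <- supp S] k
                | _ => 0%N
                end)
    (fun a k => match a with
                | 0%N => nth 0 [seq S p.1 p.2 | p <- supp S] k
                | _ => 0
                end).

(* The answer is read in integer scalar 0. *)
Definition output (R : Type) (s : state R) : nat := nvar s 0.

(* Polylogarithmic factor in n and 1/eps; the 1 keeps it from degenerating at
   n = 1, eps close to 1. *)
Definition polylog (R : realType) (k n : nat) (eps : R) : R :=
  (1 + ln n%:R + ln eps^-1) ^+ k.

(* Main.v *)
Require Import Defs.
From mathcomp Require Import all_boot all_order all_algebra.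
From mathcomp Require Import boolp classical_sets reals exp.
From mathcomp Require Import fingroup finfield complex spectral sesquilinear.
From mathcomp Require Import ring lra zify.

(* Sample A by a fixed matrix S that is close to the all-ones matrix J in spectral norm,
   ||S - J|| <= gamma^2 n with gamma = eps / polylog n; here S is n/d times the adjacency matrix of a
   Cayley graph of F_2^m whose generators form a small-bias set, so d = polylog(n) / eps^4. Let
   D_j = |A|_jj, so that the D_j sum to the nuclear norm. Writing A as a sum of lambda_i v_i v_i^T
   bounds the form of A o (S - J) between blocks of indices with D_j <= a and D_k <= b by
   gamma^2 n sqrt(a b), while at most M/a and M/b indices have D_j > a and D_k > b, so that bounded
   entries give M / sqrt(a b) + gamma^2 n, with M = max(n, ||A||_1). Balancing over dyadic blocks
   gives ||A o S - A|| <= (eps / 4) M. For a positive semidefinite A one may take M = n. Hence the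
   largest eigenvalue of 1 - (A o S) / (4n) is at most 1 + eps/16 in the first case and at least
   1 + eps/8 in the second, and the trace of its K-th power, K of order log(n) / eps, tells them apart;
   it is computed by applying the sparse matrix K times to each basis vector. *)

Set Implicit Arguments.
Unset Strict Implicit.
Unset Printing Implicit Defensive.

Import Order.TTheory GRing.Theory Num.Theory.
Local Open Scope ring_scope.

(** * Diagonalization of real symmetric matrices *)

(** Over [complex R] the matrix is Hermitian, so the spectral theorem diagonalizes it with a real
    diagonal. A diagonal entry is then a root, already in [R], of the characteristic polynomial. *)
Lemma symmetric_eigenvalue (R : rcfType) (n : nat) (A : 'M[R]_n.+1) :
  A^T = A -> exists a, eigenvalue A a.
Proof.
move=> symA; pose Ac := map_mx (real_complex R) A.
have realc x : real_complex R x \is Num.real by rewrite complex_real.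
have hermAc : Ac \is hermsymmx.
  apply: realsym_hermsym; last by apply/mxOverP => i j; rewrite mxE.
  by apply/is_hermitianmxP; rewrite expr0 scale1r map_mx_id // /Ac map_trmx symA.
have Ddef : spectralmx Ac *m Ac = diag_mx (spectral_diag Ac) *m spectralmx Ac.
  have /orthomx_spectralP {2}-> := hermitian_normalmx hermAc.
  by rewrite !mulmxA mulmxV ?spectral_unit // mul1mx.
have /mxOverP/(_ 0 0)/complex_realP[a aE] := hermitian_spectral_diag_real hermAc.
exists a; rewrite eigenvalue_root_char -(fmorph_root (real_complex R)).
rewrite map_char_poly -eigenvalue_root_char -[map_mx _ A]/Ac.
apply/eigenvalueP; exists (row 0 (spectralmx Ac)).
  by rewrite -row_mul Ddef row_mul row_diag_mx -scalemxAl -rowE aE.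
apply/eqP => /(congr1 (mulmx^~ (invmx (spectralmx Ac)))).
rewrite -row_mul mulmxV ?spectral_unit // mul0mx => /rowP/(_ 0)/eqP.
by rewrite !mxE oner_eq0.
Qed.

(* H is the Householder reflection that exchanges v and the first basis vector. *)
Lemma orthogonal_first_row (R : rcfType) (n : nat) (v : 'rV[R]_n.+1) :
  v *m v^T = 1%:M ->
  exists H : 'M[R]_n.+1, [/\ H^T = H, H *m H = 1%:M & row 0 H = v].
Proof.
move=> vv1; pose e : 'rV[R]_n.+1 := delta_mx 0 0.
have [<-|evN] := eqVneq e v.
  by exists 1%:M; rewrite trmx1 mul1mx row1.
have ee1 : e *m e^T = 1%:M.
  by rewrite /e trmx_delta mul_delta_mx; apply/matrixP => i j; rewrite !mxE !ord1.
have [w wE] : exists w, w = e - v by exists (e - v).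
pose c := (w *m w^T) 0 0.
have wwE : w *m w^T = c%:M by rewrite [LHS]mx11_scalar.
have c_neq0 : c != 0.
  apply: contraNneq evN => c0; rewrite -subr_eq0 -wE; apply/eqP/rowP => j.
  move/eqP: c0; rewrite /c mxE psumr_eq0 => [/allP/(_ j)|i _]; last first.
    by rewrite [w^T _ _]mxE -expr2 sqr_ge0.
  by rewrite mem_index_enum [w^T _ _]mxE [RHS]mxE /= => /(_ isT); rewrite mulf_eq0 orbb => /eqP.
have ve : v *m e^T = e *m v^T.
  by rewrite [RHS]mx11_scalar [LHS]mx11_scalar; congr (_%:M); rewrite !mxE;
    apply: eq_bigr => i _; rewrite !mxE mulrC.
(* Since e and v are unit vectors, |e - v|^2 = 2 (1 - <e, v>) = 2 <e - v, e>. Hence the reflection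
   in w sends e to e - w = v. *)
have wtE : w *m e^T = (c / 2)%:M.
  have : w *m w^T = 2 *: (w *m e^T).
    rewrite wE [(_ - _)^T]linearB /= !(mulmxBl, mulmxBr) vv1 ee1 ve.
    by rewrite scalerBr !scaler_nat !mulr2n !opprB opprD addrCA -!addrA.
  rewrite wwE => /(congr1 (fun X => 2^-1 *: X)); rewrite scalerA mulVf ?pnatr_eq0 //.
  by rewrite scale1r => <-; rewrite scale_scalar_mx mulrC.
pose H := 1%:M - (2 / c) *: (w^T *m w).
exists H; split.
- by rewrite /H linearB /= trmx1 linearZ /= trmx_mul trmxK.
- rewrite /H mulmxBl mul1mx mulmxBr mulmx1 -scalemxAl -scalemxAr mulmxA.
  rewrite -(mulmxA w^T) wwE mul_mx_scalar -scalemxAl !scalerA.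
  by move: (w^T *m w) => G; apply/matrixP => i j; rewrite !mxE; field.
rewrite /H rowE mulmxBr mulmx1 -/e -scalemxAr mulmxA.
have -> : e *m w^T = (c / 2)%:M by rewrite -wtE -[LHS]trmxK trmx_mul trmxK wtE tr_scalar_mx.
rewrite mul_scalar_mx scalerA (_ : 2 / c * _ = 1) ?scale1r ?opprB ?subrKC //.
  by rewrite wE opprB addrC subrK.
by field.
Qed.

(** Deflation: conjugating by a reflection whose first row is a unit eigenvector splits off a block
    of size 1, and induction treats the rest. *)
Lemma symmetric_diagonalization (R : rcfType) (n : nat) (A : 'M[R]_n) :
  A^T = A ->
  exists (U : 'M[R]_n) (d : 'rV[R]_n),
    U *m U^T = 1%:M /\ A = U^T *m diag_mx d *m U.
Proof.
elim: n => [|n IHn] in A *; first by exists 1%:M, 0; split; rewrite [LHS]flatmx0 [RHS]flatmx0.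
move=> symA; have [a /eigenvalueP[v vA v_neq0]] := symmetric_eigenvalue symA.
pose c := (v *m v^T) 0 0.
have c_gt0 : 0 < c.
  have c_ge0 : 0 <= c by rewrite /c mxE sumr_ge0 // => i _; rewrite mxE -expr2 sqr_ge0.
  rewrite lt_def c_ge0 andbT; apply: contra v_neq0 => /eqP c0.
  apply/eqP/rowP => j; move/eqP: c0; rewrite /c mxE psumr_eq0 => [/allP/(_ j)|i _].
    by rewrite mem_index_enum !mxE /= => /(_ isT); rewrite mulf_eq0 orbb => /eqP.
  by rewrite mxE -expr2 sqr_ge0.
pose s := (Num.sqrt c)^-1; pose u := s *: v.
have uA : u *m A = a *: u by rewrite -scalemxAl vA !scalerA mulrC.
have uu : u *m u^T = 1%:M.
  rewrite [u^T]linearZ /= -scalemxAr -scalemxAl scalerA [v *m _]mx11_scalar -/c.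
  rewrite scale_scalar_mx -invfM -expr2 sqr_sqrtr ?ltW // mulVf ?gt_eqF //.
have [H [symH HH rowH]] := orthogonal_first_row uu.
have [B BHAH] : exists B : 'M[R]_(1 + n), B = H *m A *m H by exists (H *m A *m H).
have symB : B^T = B by rewrite BHAH !trmx_mul symH symA mulmxA.
have row0B : row 0 B = a *: delta_mx 0 0.
  by rewrite BHAH !row_mul rowH uA -scalemxAl -rowH -row_mul HH row1.
have ur0 : ursubmx B = 0.
  apply/matrixP => i j; rewrite !mxE !ord1.
  move/rowP/(_ (rshift 1 j)): row0B; rewrite !mxE /= mulr0 => <-.
  by congr (B _ _); apply/val_inj.
have dl0 : dlsubmx B = 0 by rewrite -[B]symB -trmx_ursub ur0 trmx0.
have ul : ulsubmx B = a%:M.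
  apply/matrixP => i j; rewrite !mxE !ord1.
  move/rowP/(_ 0): row0B; rewrite !mxE /= mulr1 => <-.
  by congr (B _ _); apply/val_inj.
have symB' : (drsubmx B)^T = drsubmx B by rewrite trmx_drsub symB.
have [V [d [VV B'E]]] := IHn _ symB'.
pose W : 'M[R]_(1 + n) := block_mx 1%:M 0 0 V.
have WW : W *m W^T = 1%:M.
  rewrite /W tr_block_mx mulmx_block trmx1 !trmx0 !mulmx0 !mul0mx mul1mx VV.
  by rewrite !(addr0, add0r) -scalar_mx_block.
have BE : B = W^T *m diag_mx (row_mx a%:M d) *m W.
  rewrite diag_mx_row /W tr_block_mx !mulmx_block trmx1 !trmx0.
  rewrite !(mulmx0, mul0mx, mul1mx, mulmx1, addr0, add0r) -B'E.
  rewrite -[LHS]submxK ur0 dl0 ul; congr block_mx.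
  by rewrite [RHS]mx11_scalar !mxE.
exists (W *m H), (row_mx a%:M d); split.
  by rewrite trmx_mul symH mulmxA -(mulmxA W) HH mulmx1.
rewrite trmx_mul symH -!mulmxA [_ *m (W *m H)]mulmxA [W^T *m _]mulmxA.
rewrite [W^T *m _]mulmxA -BE BHAH.
by rewrite !mulmxA HH mul1mx -mulmxA HH mulmx1.
Qed.

Lemma char_poly_conj_orthogonal (R : comUnitRingType) (n : nat) (U : 'M[R]_n) (d : 'rV[R]_n) :
  U *m U^T = 1%:M ->
  char_poly (U^T *m diag_mx d *m U) = \prod_i ('X - (d 0 i)%:P).
Proof.
move=> UU.
have -> : \prod_i ('X - (d 0 i)%:P) = char_poly (diag_mx d).
  rewrite char_poly_trig ?diag_mx_is_trig //; apply: eq_bigr => i _.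
  by rewrite mxE eqxx.
have UtU := mulmx1C UU.
rewrite /char_poly /char_poly_mx !map_mxM /=; set P := map_mx _ U.
have PP : map_mx polyC U^T *m P = 1%:M by rewrite -map_mxM UtU map_mx1.
have XE : 'X%:M = map_mx polyC U^T *m 'X%:M *m P.
  by rewrite mul_mx_scalar -scalemxAl PP scalemx1.
by rewrite [in LHS]XE -mulmxBl -mulmxBr !det_mulmx mulrAC -det_mulmx PP det1 mul1r.
Qed.

(** * Eigenvalues and nuclear norm read off a diagonalization *)

Section EigenvaluesOfDiagonalization.
Variables (R : realType) (n : nat) (U : 'M[R]_n) (d : 'rV[R]_n).
Hypothesis UU : U *m U^T = 1%:M.

Lemma perm_eigvals :
  perm_eq (eigvals (U^T *m diag_mx d *m U)) [seq d 0 i | i : 'I_n].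
Proof.
have cpE : char_poly (U^T *m diag_mx d *m U) =
    \prod_(x <- [seq d 0 i | i : 'I_n]) ('X - x%:P).
  by rewrite char_poly_conj_orthogonal // big_image.
rewrite /eigvals; case: xgetP => [s _ [_ sE]|].
  by apply: prod_XsubC_eq; rewrite -sE cpE.
(* The default value of [xget] is ruled out: the sorted diagonal is a witness. *)
move=> /(_ (sort >=%R [seq d 0 i | i : 'I_n])) []; split.
  by apply: sort_sorted => x y; exact: le_total.
by rewrite cpE; apply: perm_big; rewrite perm_sym perm_sort.
Qed.

Lemma sorted_eigvals : sorted >=%R (eigvals (U^T *m diag_mx d *m U)).
Proof. by rewrite /eigvals; case: xgetP => [s _ []|]. Qed.

Lemma last_eigval :  (0 < n)%N ->
  exists2 i, (eigvals (U^T *m diag_mx d *m U))`_n.-1 = d 0 i &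
    forall j, d 0 i <= d 0 j.
Proof.
move=> n_gt0; set s := eigvals _.
have sz : size s = n by rewrite (perm_size perm_eigvals) size_image card_ord.
have : s`_n.-1 \in s by rewrite mem_nth // sz prednK.
rewrite (perm_mem perm_eigvals) => /mapP[i _ sE]; exists i => // j.
have : d 0 j \in s by rewrite (perm_mem perm_eigvals) map_f ?mem_enum.
case/(nthP 0) => k; rewrite sz => k_lt <-; rewrite -sE.
have ge_trans : transitive (>=%R : rel R) by move=> x y z xy yz; apply: le_trans yz xy.
have ge_refl : reflexive (>=%R : rel R) by move=> x /=.
apply: (sorted_leq_nth ge_trans ge_refl 0 sorted_eigvals); rewrite ?inE ?sz ?prednK //.
by rewrite -ltnS prednK.
Qed.
End EigenvaluesOfDiagonalization.

Lemma nuclear_norm_diagonalization (R : realType) (n : nat) (U : 'M[R]_n) (d : 'rV[R]_n) :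
  U *m U^T = 1%:M ->
  nuclear_norm (U^T *m diag_mx d *m U) = \sum_i `|d 0 i|.
Proof.
move=> UU; rewrite /nuclear_norm; set d2 := \row_i (d 0 i) ^+ 2.
have -> : (U^T *m diag_mx d *m U)^T *m (U^T *m diag_mx d *m U) =
    U^T *m diag_mx d2 *m U.
  rewrite !trmx_mul trmxK tr_diag_mx !mulmxA -[_ *m U *m U^T]mulmxA UU mulmx1.
  rewrite -[_ *m diag_mx d *m diag_mx d]mulmxA mulmx_diag.
  by congr (_ *m diag_mx _ *m _); apply/rowP => i; rewrite !mxE expr2.
rewrite (perm_big _ (perm_eigvals _ UU)) big_image /=.
by apply: eq_bigr => i _; rewrite mxE sqrtr_sqr.
Qed.

(** * Sampling matrices from small-bias sets *)

(** Coordinates over F_2 for the field with 2^r elements: polynomials are evaluated in the field,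
    and their values are then fed to characters of F_2^r. *)
Lemma binary_field (r : nat) : (0 < r)%N ->
  exists (F : finFieldType) (phi : F -> 'rV['F_2]_r),
    [/\ {morph phi : a b / a + b}, injective phi & #|F| = (2 ^ r)%N].
Proof.
move=> r_gt0; have [F char2 cardF] := pPrimePowerField (isT : prime 2) r_gt0.
have [v2r linv bijv] := pprimeChar_vectAxiom char2.
exists F; have rE : logn 2 #|F| = r by rewrite cardF pfactorK.
move: v2r linv bijv; rewrite [#|_|](_ : _ = #|F|) // rE => v2r linv bijv.
exists v2r; split=> //; last exact: bij_inj.
by move=> a b; have := linv 1 a b; rewrite !scale1r.
Qed.

(** * Characters of F_2^m and small-bias families *)

Section Characters.
Variable R : realFieldType.

Definition sgn2 (a : 'F_2) : R := (-1) ^+ a.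

Lemma sgn2D : {morph sgn2 : a b / a + b >-> a * b}.
Proof.
move=> a b; rewrite /sgn2 -exprD -signr_odd -[in RHS]signr_odd; congr (_ ^+ _).
by case: a => [[|[|//]]] ?; case: b => [[|[|//]]] ?.
Qed.

Definition chi (m : nat) (z u : 'rV['F_2]_m) : R := sgn2 ((z *m u^T) 0 0).

Lemma chiC m (z u : 'rV['F_2]_m) : chi z u = chi u z.
Proof.
by rewrite /chi !mxE; congr sgn2; apply: eq_bigr => i _; rewrite !mxE mulrC.
Qed.

Lemma chiDr m (z u v : 'rV['F_2]_m) : chi z (u + v) = chi z u * chi z v.
Proof. by rewrite /chi linearD mulmxDr mxE sgn2D. Qed.

Lemma chi0l m (u : 'rV['F_2]_m) : chi 0 u = 1.
Proof. by rewrite /chi mul0mx mxE /sgn2 expr0. Qed.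

Lemma sum_chi m (z : 'rV['F_2]_m) :
  \sum_u chi z u = (2 ^ m)%:R * (z == 0)%:R.
Proof.
have [->|z_neq0] := eqVneq z 0.
  under eq_bigr do rewrite chi0l.
  by rewrite sumr_const card_mx card_Fp // mul1n mulr1.
have [i zi] : exists i, z 0 i != 0.
  apply/existsP; apply: contraNT z_neq0 => /existsPn z0.
  by apply/eqP/rowP => i; rewrite mxE; apply/eqP; have := z0 i; rewrite negbK.
(* Translation by u0 flips the sign of every term, so the sum equals its own opposite. *)
pose u0 : 'rV['F_2]_m := delta_mx 0 i.
have chi_u0 : chi z u0 = -1.
  rewrite /chi /u0 trmx_delta -colE mxE /sgn2.
  by case: (z 0 i) zi => [[|[|//]]] // ? _; rewrite expr1.
rewrite mulr0; apply/eqP; rewrite -[_ == 0](@mulrn_eq0 _ _ 2) mulr2n; apply/eqP.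
rewrite {2}(reindex_inj (addIr u0)) /= -big_split big1 //= => u _.
by rewrite chiDr chi_u0 mulrN1 subrr.
Qed.

(* The powering construction of Alon, Goldreich, Hastad and Peralta: the character sums of this
   family count the roots in F of polynomials of degree less than m. *)
Lemma small_bias_family (m r : nat) : (0 < r)%N ->
  exists (T : finType) (g : T -> 'rV['F_2]_m),
    #|T| = (4 ^ r)%N /\
    forall z, z != 0 -> `|\sum_t chi z (g t)| <= m%:R / (2 ^ r)%:R * #|T|%:R.
Proof.
move=> r_gt0; have [F [phi [phiD phi_inj cardF]]] := binary_field r_gt0.
pose T : finType := (F * 'rV['F_2]_r)%type.
pose g (t : T) : 'rV['F_2]_m := \row_i (t.2 *m (phi (t.1 ^+ i))^T) 0 0.
have cardT : #|T| = (4 ^ r)%N.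
  by rewrite card_prod cardF card_mx card_Fp // mul1n -expnMn.
exists T, g; split=> // z z_neq0.
(* Pairing z with [g (x, y)] amounts to pairing y with p(x), where the coefficients of p are the
   bits of z. Summing over y gives 2^r at each root of p and 0 elsewhere. *)
pose p : {poly F} := \poly_(i < m) (if insub i is Some j then (z 0 j : nat)%:R else 0).
have phi0 : phi 0 = 0 by apply: (addrI (phi 0)); rewrite -phiD !addr0.
have phiMn a k : phi (a *+ k) = phi a *+ k.
  by elim: k => [|k IHk]; rewrite ?mulr0n // !mulrS phiD IHk.
have phi_sum (G : 'I_m -> F) : phi (\sum_i G i) = \sum_i phi (G i) by exact: big_morph.
have chi_g t : chi z (g t) = chi t.2 (phi p.[t.1]).
  rewrite horner_poly phi_sum /chi; congr sgn2; rewrite linear_sum mulmx_sumr summxE mxE.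
  apply: eq_bigr => i _; rewrite !mxE valK.
  rewrite mulr_natl phiMn mulr_sumr; apply: eq_bigr => j _.
  by rewrite [in RHS]mxE mulmxnE mulrnAr -mulr_natl natr_Zp ![_^T _ _]mxE.
have sumT : \sum_t chi z (g t) = (2 ^ r)%:R * #|[pred x : F | p.[x] == 0]|%:R.
  under eq_bigr do rewrite chi_g.
  rewrite -(pair_bigA _ (fun x y => chi y (phi p.[x]))) /=.
  under eq_bigr => x _ do under eq_bigr do rewrite chiC.
  under eq_bigr do rewrite sum_chi -{1}phi0 (inj_eq phi_inj).
  by rewrite -mulr_sumr -natr_sum -sum1_card [in RHS]big_mkcond.
have p_neq0 : p != 0.
  apply: contraNneq z_neq0 => p0; apply/eqP/rowP => i; rewrite mxE.
  have := congr1 (fun q : {poly F} => q`_i) p0.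
  rewrite coef_poly ltn_ord coef0 valK => /(congr1 phi)/eqP.
  have phi1 : phi 1 != 0 by rewrite -phi0 (inj_eq phi_inj) oner_eq0.
  rewrite phi0 phiMn; case: (z 0 i) => [[|[|//]]] //= lti; first by move=> _; apply/val_inj.
  by rewrite mulr1n (negPf phi1).
have roots_lt : (#|[pred x : F | p.[x] == 0%R]| <= m)%N.
  have sizep : (size p <= m)%N by exact: size_poly.
  apply: leq_trans sizep; rewrite cardE;
  apply/ltnW/(@max_poly_roots F p (enum [pred x : F | p.[x] == 0]) p_neq0).
    by apply/allP => x; rewrite mem_enum.
  exact: enum_uniq.
rewrite sumT ger0_norm ?mulr_ge0 ?ler0n // cardT (expnMn 2 2) natrM.
rewrite -mulrA (mulKf (_ : (2 ^ r)%:R != 0)) ?pnatr_eq0 ?expn_eq0 // mulrC.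
by rewrite ler_wpM2r ?ler0n ?ler_nat.
Qed.
End Characters.

Lemma addv_eq0 m (u v : 'rV['F_2]_m) : (u + v == 0) = (u == v).
Proof.
rewrite -[u == v](inj_eq (addIr v)); congr (_ == _).
by apply/rowP => k; rewrite !mxE -mulr2n -mulr_natr pchar_Zp ?mulr0.
Qed.

(** * The Cayley graph sampling matrix and its spectral distance to J *)

Section CayleySampling.
Variables (R : realFieldType) (m n : nat) (T : finType) (g : T -> 'rV['F_2]_m).
Variables (f : 'I_n -> 'rV['F_2]_m) (delta : R).
Hypothesis f_inj : injective f.
Hypothesis delta_ge0 : 0 <= delta.
Hypothesis T_gt0 : (0 < #|T|)%N.
Hypothesis g_bias : forall z, z != 0 -> `|\sum_t chi R z (g t)| <= delta * #|T|%:R.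

(** Adjacency matrix of the Cayley multigraph of F_2^m with generators g, induced on the vertices
    [f i] and scaled so that the trivial character contributes exactly J. *)
Definition cayley_sampling : 'M[R]_n :=
  \matrix_(i, j) ((2 ^ m)%:R / #|T|%:R * #|[set t | g t == f i + f j]|%:R).

Lemma cayley_sampling_sym : cayley_sampling^T = cayley_sampling.
Proof. by apply/matrixP => i j; rewrite !mxE addrC. Qed.

Lemma cayley_sampling_ge0 i j : 0 <= cayley_sampling i j.
Proof. by rewrite mxE !mulr_ge0 ?invr_ge0 ?ler0n. Qed.

(** A nonzero entry at (i, j) forces [f i + f j] to be a generator, and i together with that
    generator determines j. *)
Lemma supp_sampling_le :
  (#|[set p : 'I_n * 'I_n | cayley_sampling p.1 p.2 != 0%R]| <= n * #|T|)%N.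
Proof.
set P := [set p | _]; pose h (p : 'I_n * 'I_n) := (p.1, f p.1 + f p.2).
have h_inj : injective h.
  by case=> i j [i' j'] [<- /addrI/f_inj ->].
have sub : h @: P \subset [set (it.1, g it.2) | it in [set: 'I_n * T]].
  apply/fintype.subsetP => _ /imsetP[[i j] ijP ->]; move: ijP; rewrite inE mxE /= => ijP.
  have /card_gt0P[t] : (0 < #|[set t | g t == (f i + f j)%R]|)%N.
    by rewrite lt0n; apply: contra ijP => /eqP ->; rewrite mulr0.
  by rewrite inE => /eqP gt; apply/imsetP; exists (i, t); rewrite ?inE //= gt.
rewrite -(card_imset _ h_inj); apply: leq_trans (subset_leq_card sub) _.
by apply: leq_trans (leq_imset_card _ _) _; rewrite cardsT card_prod card_ord.
Qed.

Let bias z := (\sum_t chi R z (g t)) / #|T|%:R.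

(** Fourier inversion: the normalized character sums of the generators are the coefficients of the
    characters. *)
Lemma cayley_samplingE i j :
  cayley_sampling i j = \sum_z bias z * (chi R z (f i) * chi R z (f j)).
Proof.
rewrite mxE /bias.
have -> : \sum_z (\sum_t chi R z (g t)) / #|T|%:R * (chi R z (f i) * chi R z (f j)) =
   #|T|%:R^-1 * \sum_t \sum_z chi R (g t + (f i + f j)) z.
  rewrite exchange_big mulr_sumr; apply: eq_bigr => z _.
  rewrite mulrAC mulrC; congr (_ * _); rewrite mulr_suml.
  by apply: eq_bigr => t _; rewrite (chiC _ _ z) !chiDr.
under eq_bigr do rewrite sum_chi addv_eq0.
rewrite -mulr_sumr mulrA [_^-1 * _]mulrC; congr (_ * _).
rewrite -natr_sum -sum1_card; congr (_%:R); rewrite [LHS]big_mkcond /=.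
by apply: eq_bigr => t _; rewrite inE; case: eqP.
Qed.

Lemma parseval (p : 'I_n -> R) :
  \sum_z (\sum_i p i * chi R z (f i)) ^+ 2 = (2 ^ m)%:R * \sum_i p i ^+ 2.
Proof.
have E z : (\sum_i p i * chi R z (f i)) ^+ 2 =
    \sum_i \sum_j p i * p j * chi R (f i + f j) z.
  rewrite expr2 mulr_suml; apply: eq_bigr => i _; rewrite mulr_sumr.
  by apply: eq_bigr => j _; rewrite (chiC _ _ z) chiDr mulrACA.
under eq_bigr do rewrite E.
rewrite exchange_big mulr_sumr; apply: eq_bigr => i _ /=; rewrite exchange_big /=.
rewrite (bigD1 i) //= [X in _ + X]big1 => [|j ji]; last first.
  by rewrite -mulr_sumr sum_chi addv_eq0 (inj_eq f_inj) eq_sym (negPf ji) !mulr0.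
by rewrite addr0 -mulr_sumr sum_chi addv_eq0 eqxx mulr1 mulrC expr2.
Qed.

(** The term z = 0 of the Fourier expansion is J, and all other coefficients are at most delta. The
    weight t stands in for Cauchy-Schwarz through 2 |P Q| <= t P^2 + Q^2 / t, without square roots;
    Parseval then returns to p and q. *)
Lemma cayley_sampling_form (p q : 'I_n -> R) (t : R) : 0 < t ->
  `|\sum_i \sum_j p i * (cayley_sampling i j - 1) * q j| <=
    delta * (2 ^ m)%:R / 2 * (t * (\sum_i p i ^+ 2) + t^-1 * \sum_i q i ^+ 2).
Proof.
move=> t_gt0; pose P z := \sum_i p i * chi R z (f i).
pose Q z := \sum_i q i * chi R z (f i).
have E i j : cayley_sampling i j - 1 =
    \sum_(z | z != 0) bias z * (chi R z (f i) * chi R z (f j)).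
  rewrite cayley_samplingE (bigD1 0) //= addrC /bias.
  under [\sum_t chi R 0 _]eq_bigr do rewrite chi0l.
  by rewrite !chi0l sumr_const cardT divff ?pnatr_eq0 -?cardT -?lt0n // !mulr1 addrK.
have -> : \sum_i \sum_j p i * (cayley_sampling i j - 1) * q j =
    \sum_(z | z != 0) bias z * (P z * Q z).
  under eq_bigr => i _ do under eq_bigr => j _ do rewrite E mulr_sumr mulr_suml.
  under eq_bigr do rewrite exchange_big.
  rewrite exchange_big; apply: eq_bigr => z _; rewrite /P /Q mulr_suml mulr_sumr.
  by apply: eq_bigr => i _; rewrite !mulr_sumr; apply: eq_bigr => j _; ring.
have bound z : z != 0 ->
    `|bias z * (P z * Q z)| <= delta / 2 * (t * P z ^+ 2 + t^-1 * Q z ^+ 2).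
  move=> z_neq0; rewrite normrM -mulrA; apply: ler_pM => //.
    rewrite /bias normrM normfV normr_nat ler_pdivrMr ?ltr0n //.
    exact: g_bias.
  have halfsq_ge0 x : 0 <= t^-1 * x ^+ 2 / 2.
    by apply: divr_ge0 => //; rewrite mulr_ge0 ?invr_ge0 ?sqr_ge0 ?(ltW t_gt0).
  have t_neq0 : t != 0 by rewrite gt_eqF.
  rewrite ler_norml -(subr_ge0 _ (P z * Q z)) -(subr_ge0 (P z * Q z)); apply/andP; split.
    have -> : P z * Q z - - (2^-1 * (t * P z ^+ 2 + t^-1 * Q z ^+ 2)) =
        t^-1 * (t * P z + Q z) ^+ 2 / 2 by field.
    exact: halfsq_ge0.
  have -> : 2^-1 * (t * P z ^+ 2 + t^-1 * Q z ^+ 2) - P z * Q z =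
      t^-1 * (t * P z - Q z) ^+ 2 / 2 by field.
  exact: halfsq_ge0.
apply: le_trans (ler_norm_sum _ _ _) _.
apply: le_trans (ler_sum _ (fun z hz => bound z hz)) _.
have -> : delta * (2 ^ m)%:R / 2 * (t * (\sum_i p i ^+ 2) + t^-1 * \sum_i q i ^+ 2) =
    \sum_z delta / 2 * (t * P z ^+ 2 + t^-1 * Q z ^+ 2).
  by rewrite -mulr_sumr big_split -!mulr_sumr /= !parseval; field; rewrite gt_eqF.
rewrite [leRHS](bigID (fun z => z != 0)) lerDl sumr_ge0 // => z _.
apply: mulr_ge0; first by apply: divr_ge0.
by apply: addr_ge0; apply: mulr_ge0; rewrite ?invr_ge0 ?sqr_ge0 ?ltW.
Qed.
End CayleySampling.

Lemma exists_sampling (R : realType) (n : nat) (delta : R) :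
    (0 < n)%N -> 0 < delta -> delta < 1 ->
  exists S : 'M[R]_n,
    [/\ S^T = S, forall i j, 0 <= S i j,
        forall (p q : 'I_n -> R) t, 0 < t ->
          `|\sum_i \sum_j p i * (S i j - 1) * q j| <=
            delta * n%:R * (t * (\sum_i p i ^+ 2) + t^-1 * \sum_i q i ^+ 2)
      & (#|[set p : 'I_n * 'I_n | S p.1 p.2 != 0]|)%:R <=
          4 * n%:R * (trunc_log 2 n).+1%:R ^+ 2 / delta ^+ 2].
Proof.
move=> n_gt0 delta_gt0 delta_lt1; pose m := (trunc_log 2 n).+1.
have /andP[lo hi] : (2 ^ trunc_log 2 n <= n < 2 ^ m)%N by exact: trunc_log_bounds.
have md_gt1 : 1 < m%:R / delta.
  by rewrite ltr_pdivlMr // mul1r (lt_le_trans delta_lt1) // ler1n.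
have pow_unbounded : exists r, m%:R / delta <= (2 ^ r)%:R.
  exists (Num.bound (m%:R / delta)); apply/ltW.
  have /archi_boundP := ltW (lt_trans ltr01 md_gt1).
  by move/lt_trans; apply; rewrite ltr_nat ltn_expl.
(* The least exponent with m / 2^r <= delta. Minimality bounds 2^r by 2 m / delta, hence the number
   4^r of generators by 4 (m / delta)^2. *)
case: (ex_minnP pow_unbounded) => r r_le r_min.
case: r => [|r] in r_le r_min; first by rewrite expn0 leNgt md_gt1 in r_le.
have r_lt : (2 ^ r)%:R < m%:R / delta.
  by rewrite ltNge; apply/negP => /r_min; rewrite ltnn.
have [T [g [cardT g_bias]]] := small_bias_family R m (isT : (0 < r.+1)%N).
have cardV : (n <= #|{: 'rV['F_2]_m}|)%N by rewrite card_mx card_Fp // mul1n ltnW.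
pose f (i : 'I_n) : 'rV['F_2]_m := enum_val (widen_ord cardV i).
have f_inj : injective f.
  by move=> i j /enum_val_inj/(congr1 val) /= ij; apply: val_inj.
have T_gt0 : (0 < #|T|)%N by rewrite cardT expn_gt0.
have bias z : z != 0 -> `|\sum_t chi R z (g t)| <= delta * #|T|%:R.
  move=> /g_bias/le_trans; apply; rewrite ler_wpM2r ?ler0n //.
  by rewrite ler_pdivrMr ?ltr0n ?expn_gt0 // mulrC -ler_pdivrMr.
exists (cayley_sampling R g f); split.
- exact: cayley_sampling_sym.
- exact: cayley_sampling_ge0.
- move=> p q t t_gt0.
  apply: le_trans (cayley_sampling_form f_inj (ltW delta_gt0) T_gt0 bias _ _ t_gt0) _.
  rewrite ler_wpM2r //.
    by rewrite addr_ge0 // mulr_ge0 ?invr_ge0 ?(ltW t_gt0) // sumr_ge0 // => i _; rewrite sqr_ge0.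
  (* As 2^m is twice a power of 2 that is at most n, the factor 1/2 of the form bound turns 2^m into
     n. *)
  rewrite -mulrA ler_pM2l // ler_pdivrMr // -natrM ler_nat expnS mulnC.
  by rewrite leq_pmul2r.
apply: le_trans (_ : (n * #|T|)%:R <= _); first by rewrite ler_nat supp_sampling_le.
rewrite cardT natrM (_ : _ / _ = n%:R * (4 * (m%:R / delta) ^+ 2)); last first.
  by rewrite /m; field; rewrite gt_eqF.
rewrite ler_pM2l ?ltr0n // expnS natrM ler_pM2l // (expnMn 2 2) natrM -expr2.
by rewrite lerXn2r ?nnegrE ?ler0n ?ltW // (lt_trans ltr01).
Qed.

(** * Universal sparsification *)

Lemma sqr_sum_le_card (R : realFieldType) (I : finType) (P : pred I) (u : I -> R) :
  (\sum_(i | P i) u i) ^+ 2 <= #|P|%:R * \sum_(i | P i) u i ^+ 2.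
Proof.
have -> : #|P|%:R * \sum_(i | P i) u i ^+ 2 =
    \sum_(i | P i) \sum_(j | P j) (u i ^+ 2 + u j ^+ 2) / 2.
  under [RHS]eq_bigr do rewrite -mulr_suml big_split sumr_const /=.
  by rewrite -mulr_suml big_split /= sumr_const sumrMnl mulr_natl mulrDl -splitr.
rewrite expr2 mulr_suml; apply: ler_sum => i _; rewrite mulr_sumr.
apply: ler_sum => j _; have := sqr_ge0 (u i - u j); nra.
Qed.

Section UniversalSparsifier.
Variables (R : realFieldType) (n : nat) (A U S : 'M[R]_n) (d : 'rV[R]_n).
Variables (M gamma : R) (L : nat).
Hypothesis UU : U *m U^T = 1%:M.
Hypothesis AE : A = U^T *m diag_mx d *m U.
Hypothesis A_bounded : forall i j, `|A i j| <= 1.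
Hypothesis S_ge0 : forall i j, 0 <= S i j.
Hypothesis gamma_gt0 : 0 < gamma.
Hypothesis gamma_le1 : gamma <= 1.
Hypothesis S_expander : forall (p q : 'I_n -> R) t, 0 < t ->
  `|\sum_i \sum_j p i * (S i j - 1) * q j| <=
    gamma ^+ 2 * n%:R * (t * (\sum_i p i ^+ 2) + t^-1 * \sum_i q i ^+ 2).
Hypothesis n_leM : n%:R <= M.
Hypothesis nuclear_leM : \sum_i `|d 0 i| <= M.
Hypothesis n_le4L : (n <= 4 ^ L)%N.

(* D is the diagonal of |A|, the square root of A^T A. *)
Let D j := \sum_i `|d 0 i| * U i j ^+ 2.
Let W j k := A j k * (S j k - 1).

Lemma entry_diagonalization j k : A j k = \sum_i d 0 i * (U i j * U i k).
Proof.
rewrite AE mxE; apply: eq_bigr => i _; rewrite mul_mx_diag !mxE; ring.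
Qed.

Lemma sum_sqr_row i : \sum_j U i j ^+ 2 = 1.
Proof.
have /matrixP/(_ i i) := UU; rewrite !mxE eqxx => E; apply: etrans E.
by apply: eq_bigr => j _; rewrite mxE expr2.
Qed.

Lemma sum_sqr_col j : \sum_i U i j ^+ 2 = 1.
Proof.
have /matrixP/(_ j j) := mulmx1C UU; rewrite !mxE eqxx => E; apply: etrans E.
by apply: eq_bigr => i _; rewrite mxE expr2.
Qed.

Lemma sum_abs_diag : \sum_j D j <= M.
Proof.
apply: le_trans nuclear_leM; rewrite exchange_big /=.
by under eq_bigr do rewrite -mulr_sumr sum_sqr_row mulr1.
Qed.

Lemma abs_diag_ge0 j : 0 <= D j.
Proof. by apply: sumr_ge0 => i _; rewrite mulr_ge0 ?sqr_ge0. Qed.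

(** Apply |d| <= (d^2 + 1) / 2 termwise: the sum of d_i^2 U_ij^2 is the squared norm of row j of A,
    at most n, so D_j is at most (n + 1) / 2. *)
Lemma abs_diag_le j : D j <= n%:R.
Proof.
have sq : \sum_i d 0 i ^+ 2 * U i j ^+ 2 = \sum_k A j k ^+ 2.
  have -> : \sum_k A j k ^+ 2 = (A *m A^T) j j.
    by rewrite mxE; apply: eq_bigr => k _; rewrite mxE expr2.
  rewrite {1}AE -mulmxA [A^T](_ : _ = U^T *m (diag_mx d *m U)); last first.
    by rewrite AE !trmx_mul trmxK tr_diag_mx mulmxA.
  rewrite [U *m _]mulmxA UU mul1mx mxE; apply: eq_bigr => i _.
  by rewrite mul_mx_diag mul_diag_mx !mxE; ring.
have sq_le : \sum_i d 0 i ^+ 2 * U i j ^+ 2 <= n%:R.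
  rewrite sq -[n in leRHS]card_ord -sumr_const; apply: ler_sum => k _.
  by rewrite -(real_normK (num_real (A j k))) expr_le1.
have n_ge1 : 1 <= n%:R :> R by rewrite ler1n (leq_trans _ (ltn_ord j)).
apply: (@le_trans _ _ (\sum_i (d 0 i ^+ 2 * U i j ^+ 2 + U i j ^+ 2) / 2)).
  apply: ler_sum => i _; have := sqr_ge0 (`|d 0 i| - 1); have := sqr_ge0 (U i j).
  by rewrite sqrrB1 real_normK ?num_real //; nra.
by rewrite -mulr_suml big_split /= sum_sqr_col; lra.
Qed.

(** An eigenvector u_i of A contributes d_i times the form of S - J at the entrywise products of u_i
    with x and y. Summing the squared norms with weights |d_i| produces D. *)
Lemma spectral_bound (x y : 'I_n -> R) t : 0 < t ->
  `|\sum_j \sum_k x j * W j k * y k| <=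
    gamma ^+ 2 * n%:R * (t * (\sum_j D j * x j ^+ 2) + t^-1 * \sum_j D j * y j ^+ 2).
Proof.
move=> t_gt0.
have -> : \sum_j \sum_k x j * W j k * y k =
    \sum_i d 0 i * \sum_j \sum_k (U i j * x j) * (S j k - 1) * (U i k * y k).
  under [RHS]eq_bigr do rewrite mulr_sumr.
  rewrite [RHS]exchange_big; apply: eq_bigr => j _ /=.
  under [RHS]eq_bigr do rewrite mulr_sumr.
  rewrite [RHS]exchange_big; apply: eq_bigr => k _ /=.
  rewrite /W entry_diagonalization mulr_suml mulr_sumr mulr_suml.
  by apply: eq_bigr => i _; ring.
apply: le_trans (ler_norm_sum _ _ _) _.
apply: (@le_trans _ _ (\sum_i `|d 0 i| * (gamma ^+ 2 * n%:R * (t * (\sum_j (U i j * x j) ^+ 2)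
     + t^-1 * \sum_j (U i j * y j) ^+ 2)))).
  by apply: ler_sum => i _; rewrite normrM ler_wpM2l // S_expander.
have DE z : \sum_j D j * z j ^+ 2 = \sum_i `|d 0 i| * \sum_j (U i j * z j) ^+ 2.
  under [RHS]eq_bigr do rewrite mulr_sumr.
  rewrite [RHS]exchange_big; apply: eq_bigr => j _; rewrite mulr_suml.
  by apply: eq_bigr => i _; ring.
rewrite !DE !mulr_sumr -big_split mulr_sumr le_eqVlt; apply/orP; left; apply/eqP.
by apply: eq_bigr => i _ /=; ring.
Qed.

(** As S is nonnegative, |S - 1| <= 2 + (S - 1). The constant gives the product of the l1 norms, and
    the expander bound at t = 1 controls the rest. *)
Lemma trivial_bound (x y : 'I_n -> R) :
  `|\sum_j \sum_k x j * W j k * y k| <=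
    2 * ((\sum_j `|x j|) * (\sum_j `|y j|)) +
    gamma ^+ 2 * n%:R * (\sum_j x j ^+ 2 + \sum_j y j ^+ 2).
Proof.
have := S_expander (fun j => `|x j|) (fun j => `|y j|) ltr01.
rewrite invr1 !mul1r.
under [\sum_j `|x j| ^+ 2]eq_bigr do rewrite real_normK ?num_real //.
under [\sum_j `|y j| ^+ 2]eq_bigr do rewrite real_normK ?num_real //.
move=> /(le_trans (ler_norm _)) ES.
apply: (@le_trans _ _ (2 * ((\sum_j `|x j|) * (\sum_j `|y j|)) +
    \sum_j \sum_k `|x j| * (S j k - 1) * `|y k|)); last by rewrite lerD2l.
rewrite mulr_suml mulr_sumr -big_split /=.
apply: le_trans (ler_norm_sum _ _ _) _; apply: ler_sum => j _.
rewrite !mulr_sumr -big_split /=.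
apply: le_trans (ler_norm_sum _ _ _) _; apply: ler_sum => k _.
rewrite /W !normrM.
have -> : 2 * (`|x j| * `|y k|) + `|x j| * (S j k - 1) * `|y k| =
  `|x j| * (1 + S j k) * `|y k| by ring.
apply: ler_wpM2r => //; apply: ler_wpM2l => //.
rewrite -[leRHS]mul1r; apply: ler_pM => //.
by rewrite ler_norml; have := S_ge0 j k; lra.
Qed.

(** Level 0 gathers all indices with D_j <= 1, for which no lower bound on D_j is available; D_j <=
    n <= 4^L limits the number of levels. *)
Lemma dyadic_level :
  exists lv : 'I_n -> 'I_L.+1, forall j,
    D j <= 4 ^+ lv j /\ (lv j != 0 -> 4 ^+ lv j <= 4 * D j).
Proof.
apply: (@fin_all_exists _ (fun=> 'I_L.+1)
  (fun j a => D j <= 4 ^+ a /\ (a != 0 -> 4 ^+ a <= 4 * D j))) => j.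
have ex : exists a : nat, D j <= 4 ^+ a.
  by exists L; apply: le_trans (abs_diag_le j) _; rewrite -natrX ler_nat.
case: (ex_minnP ex) => a Da a_min.
have aL : (a <= L)%N.
  by apply: a_min; apply: le_trans (abs_diag_le j) _; rewrite -natrX ler_nat.
exists (Ordinal (aL : a < L.+1)%N); split=> //= a_neq0.
case: a => [|a] in Da a_min aL a_neq0 *; first by case/eqP: a_neq0; apply: val_inj.
rewrite exprS ler_pM2l //; apply/ltW; rewrite ltNge; apply/negP => /a_min.
by rewrite ltnn.
Qed.

Lemma universal_sparsifier (x : 'I_n -> R) :
  `|\sum_j \sum_k x j * W j k * x k| <=
    10 * L.+1%:R * gamma * M * \sum_j x j ^+ 2.
Proof.
have [lv lvP] := dyadic_level.
pose xa (a : 'I_L.+1) j := if lv j == a then x j else 0.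
have M_ge0 : 0 <= M by apply: le_trans n_leM.
pose N a : R := \sum_j xa a j ^+ 2.
have N_ge0 a : 0 <= N a by apply: sumr_ge0 => j _; rewrite sqr_ge0.
have xaE (F : 'I_n -> R -> R) a : (forall j, F j 0 = 0) ->
    \sum_j F j (xa a j) = \sum_(j | lv j == a) F j (x j).
  move=> F0; rewrite [RHS]big_mkcond; apply: eq_bigr => j _.
  by rewrite /xa; case: ifP.
have NE a : N a = \sum_(j | lv j == a) x j ^+ 2.
  by apply: (xaE (fun j v => v ^+ 2)) => j; rewrite expr0n.
have D_level (a : 'I_L.+1) : \sum_j D j * xa a j ^+ 2 <= 4 ^+ a * N a.
  rewrite /N mulr_sumr; apply: ler_sum => j _; rewrite /xa; case: eqP => [<-|_].
    by rewrite ler_wpM2r ?sqr_ge0 //; have [] := lvP j.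
  by rewrite expr0n !mulr0.
have card_level (a : 'I_L.+1) : 4 ^+ a * #|[pred j | lv j == a]|%:R <= 4 * M.
  have [->|a_neq0] := eqVneq a 0.
    rewrite expr0 mul1r; apply: (@le_trans _ _ n%:R); last by apply: le_trans n_leM _; lra.
    by rewrite ler_nat -[leqRHS]card_ord max_card.
  apply: (@le_trans _ _ (4 * \sum_j D j)); last by have := sum_abs_diag; lra.
  rewrite mulr_natr -sumr_const mulr_sumr [leRHS](bigID (fun j => lv j == a)) /=.
  rewrite -[leLHS]addr0; apply: lerD; last first.
    by apply: sumr_ge0 => j _; rewrite mulr_ge0 ?abs_diag_ge0.
  by apply: ler_sum => j /eqP lvj; have [_] := lvP j; rewrite lvj; apply.
have abs_level a : (\sum_j `|xa a j|) ^+ 2 <= #|[pred j | lv j == a]|%:R * N a.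
  rewrite (xaE (fun j v => `|v|)) => [|j]; last by rewrite normr0.
  apply: le_trans (sqr_sum_le_card _ _) _; rewrite NE.
  by under eq_bigr do rewrite real_normK ?num_real //.
have block (a b : 'I_L.+1) : `|\sum_j \sum_k xa a j * W j k * xa b k| <=
    5 * gamma * M * (N a + N b).
  have gn : gamma * n%:R <= M.
    by apply: le_trans n_leM; rewrite ler_piMl ?ler0n.
  have NN_ge0 : 0 <= N a + N b by rewrite addr_ge0.
  have pow_gt0 c : 0 < 2 ^+ c :> R by rewrite exprn_gt0.
  have four c : 4 ^+ c = 2 ^+ c * 2 ^+ c :> R by rewrite -exprMn; congr (_ ^+ _); ring.
  pose A2 : R := 2 ^+ a; pose B2 : R := 2 ^+ b.
  have A2_gt0 : 0 < A2 by exact: pow_gt0.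
  have B2_gt0 : 0 < B2 by exact: pow_gt0.
  (* The spectral bound costs gamma^2 n 2^(a+b), the trivial one M / 2^(a+b). *)
  have [K_le|K_gt] := leP (A2 * B2) gamma^-1.
    (* The weight t = 2^b / 2^a balances t 4^a and 4^b / t, both equal to 2^(a+b). *)
    apply: le_trans (spectral_bound (xa a) (xa b) (_ : 0 < B2 / A2)) _.
      by rewrite divr_gt0.
    apply: (@le_trans _ _ (gamma ^+ 2 * n%:R * (A2 * B2 * (N a + N b)))).
      apply: ler_wpM2l; first by rewrite mulr_ge0 ?sqr_ge0 ?ler0n.
      rewrite [leRHS]mulrDr; apply: lerD.
        apply: le_trans (ler_wpM2l _ (D_level a)) _; first by rewrite divr_ge0 ?ltW.
        by rewrite four -/A2 le_eqVlt; apply/orP; left; apply/eqP; field; rewrite gt_eqF.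
      apply: le_trans (ler_wpM2l _ (D_level b)) _; first by rewrite invr_ge0 divr_ge0 ?ltW.
      by rewrite four -/B2 le_eqVlt; apply/orP; left; apply/eqP; field; rewrite !gt_eqF.
    have gK : gamma * (A2 * B2) <= 1.
      by rewrite -ler_pdivlMl // mulr1.
    apply: (@le_trans _ _ (gamma * M * (N a + N b))).
      rewrite mulrA ler_wpM2r // expr2.
      have -> : gamma * gamma * n%:R * (A2 * B2) = gamma * ((gamma * (A2 * B2)) * n%:R) by ring.
      rewrite ler_pM2l //; apply: le_trans n_leM; rewrite ler_piMl ?ler0n //.
    by rewrite ler_wpM2r // ler_wpM2r // -[leLHS]mul1r ler_pM2r //; lra.
  have AB_gt0 : 0 < A2 * B2 by rewrite mulr_gt0.
  have K_lt : (A2 * B2)^-1 <= gamma.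
    by rewrite -[leRHS]invrK lef_pV2 ?posrE ?invr_gt0 // ltW.
  apply: le_trans (trivial_bound (xa a) (xa b)) _.
  set X := \sum_j `|xa a j|; set Y := \sum_j `|xa b j|.
  have X_le : A2 ^+ 2 * X ^+ 2 <= 4 * M * N a.
    apply: le_trans (ler_wpM2r (N_ge0 a) (card_level a)).
    rewrite four -/A2 -expr2 -[leRHS]mulrA ler_wpM2l ?sqr_ge0 //; exact: abs_level.
  have Y_le : B2 ^+ 2 * Y ^+ 2 <= 4 * M * N b.
    apply: le_trans (ler_wpM2r (N_ge0 b) (card_level b)).
    rewrite four -/B2 -expr2 -[leRHS]mulrA ler_wpM2l ?sqr_ge0 //; exact: abs_level.
  (* The inequality 2 (A2 X) (B2 Y) <= (A2 X)^2 + (B2 Y)^2, followed by 1 / (A2 B2) <= gamma. *)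
  have XY_le : 2 * (X * Y) <= gamma * (4 * M * (N a + N b)).
    have := sqr_ge0 (A2 * X - B2 * Y) => sq.
    apply: (@le_trans _ _ ((A2 * B2)^-1 * (4 * M * (N a + N b)))).
      rewrite ler_pdivlMl //; nra.
    by rewrite ler_wpM2r // mulr_ge0 // mulr_ge0.
  have -> : 5 * gamma * M * (N a + N b) =
    gamma * (4 * M * (N a + N b)) + gamma * M * (N a + N b) by ring.
  apply: lerD => //; rewrite -/(N a) -/(N b) ler_wpM2r // expr2 -mulrA ler_pM2l //.
have x_split j : x j = \sum_a xa a j.
  by rewrite (bigD1 (lv j)) //= /xa eqxx big1 ?addr0 // => a; rewrite eq_sym => /negPf ->.
have -> : \sum_j \sum_k x j * W j k * x k =
    \sum_a \sum_b \sum_j \sum_k xa a j * W j k * xa b k.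
  under [RHS]eq_bigr => a _ do rewrite exchange_big.
  rewrite [RHS]exchange_big; apply: eq_bigr => j _ /=.
  under [RHS]eq_bigr => a _ do rewrite exchange_big.
  rewrite [RHS]exchange_big; apply: eq_bigr => k _ /=.
  rewrite [x j]x_split [x k]x_split !mulr_suml; apply: eq_bigr => a _.
  by rewrite mulr_sumr.
have N_sum : \sum_a N a = \sum_j x j ^+ 2.
  rewrite exchange_big; apply: eq_bigr => j _ /=.
  rewrite (bigD1 (lv j)) //= /xa eqxx big1 ?addr0 // => a.
  by rewrite eq_sym => /negPf ->; rewrite expr0n.
apply: le_trans (ler_norm_sum _ _ _) _.
apply: (@le_trans _ _ (\sum_a \sum_b 5 * gamma * M * (N a + N b))).
  apply: ler_sum => a _; apply: le_trans (ler_norm_sum _ _ _) _.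
  by apply: ler_sum => b _; exact: block.
(* Summing N a + N b over all pairs counts the squared norm of x 2 (L + 1) times; with the 5 of each
   block this gives 10 (L + 1). *)
under eq_bigr => a _ do rewrite -mulr_sumr big_split sumr_const card_ord /= N_sum.
rewrite -mulr_sumr big_split /= sumrMnl N_sum sumr_const card_ord -mulr2n.
rewrite le_eqVlt; apply/orP; left; apply/eqP; ring.
Qed.
End UniversalSparsifier.

(** * The program *)

Section Hoare.
Variables (R : realType) (n : nat) (A : 'M[R]_n).
Implicit Types (P Q I : state R -> Prop) (c : com).

(** Total correctness: termination is part of the claim, and the budgets are upper bounds so that
    they can be relaxed. *)
Definition triple P c Q (q t : nat) : Prop :=
  forall s, P s -> exists s' q' t',
    [/\ exec A c s s' q' t', Q s', (q' <= q)%N & (t' <= t)%N].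

Lemma triple_seq P Q I c1 c2 q1 q2 t1 t2 :
  triple P c1 Q q1 t1 -> triple Q c2 I q2 t2 ->
  triple P (Seq c1 c2) I (q1 + q2) (t1 + t2).
Proof.
move=> H1 H2 s /H1[s1 [q1' [t1' [E1 /H2[s2 [q2' [t2' [E2 Is2 qq2 tt2]]]] qq1 tt1]]]].
by exists s2, (q1' + q2')%N, (t1' + t2')%N; split; rewrite ?leq_add //; apply: ESeq E1 E2.
Qed.

(** The invariant is indexed by the iteration count, which reaches a known N. Each iteration pays
    for one test, and the failing test adds the final 1. *)
Lemma triple_while (Inv : nat -> state R -> Prop) b c N q t :
  (forall i s, (i <= N)%N -> Inv i s -> eval_test b s = (i < N)%N) ->
  (forall i, (i < N)%N -> triple (Inv i) c (Inv i.+1) q t) ->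
  triple (Inv 0%N) (While b c) (Inv N) (N * q) (N * t.+1).+1.
Proof.
move=> test body.
suff loop k i s : (i + k = N)%N -> Inv i s -> exists s' q' t',
    [/\ exec A (While b c) s s' q' t', Inv N s', (q' <= k * q)%N & (t' <= (k * t.+1).+1)%N].
  by move=> s; apply: loop.
elim: k i s => [|k IHk] i s.
  rewrite addn0 => -> Is; exists s, 0%N, 1%N; split=> //.
  by apply: EWhileFalse; rewrite (test N) // ltnn.
move=> ikN Is; have i_lt : (i < N)%N by rewrite -ikN addnS ltnS leq_addr.
have [s1 [q1 [t1 [E1 I1 qq1 tt1]]]] := body i i_lt s Is.
have [|s2 [q2 [t2 [E2 I2 qq2 tt2]]]] := IHk i.+1 s1 _ I1; first by rewrite addSnnS.
exists s2, (q1 + q2)%N, (t1 + t2).+1; split=> //.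
- by apply: EWhileTrue E1 E2; rewrite (test i) // ltnW.
- by rewrite mulSn leq_add.
by rewrite mulSn ltnS addSn -addnS leq_add.
Qed.

Lemma triple_weaken P P' Q Q' c q q' t t' :
  triple P c Q q t -> (forall s, P' s -> P s) -> (forall s, Q s -> Q' s) ->
  (q <= q')%N -> (t <= t')%N -> triple P' c Q' q' t'.
Proof.
move=> H PP QQ qq tt s /PP/H[s' [q1 [t1 [E Qs q1q t1t]]]].
by exists s', q1, t1; split; [|exact: QQ|exact: leq_trans qq|exact: leq_trans tt].
Qed.

Fixpoint loopfree c : bool :=
  match c with
  | Seq c1 c2 => loopfree c1 && loopfree c2
  | If _ _ _ | While _ _ => false
  | _ => true
  end.

(** Symbolic evaluation of straight-line code, which reduces its triples to computation. The default
    branch is a placeholder for conditionals and loops, excluded by [loopfree]. *)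
Fixpoint run c (s : state R) : state R :=
  match c with
  | NConst x k => set_nvar s x k
  | NAdd x y z => set_nvar s x (nvar s y + nvar s z)%N
  | NSub x y z => set_nvar s x (nvar s y - nvar s z)%N
  | NLoad x a i => set_nvar s x (narr s a (nvar s i))
  | NStore a i x => set_narr s a (nvar s i) (nvar s x)
  | ROfNat r x => set_rvar s r (nvar s x)%:R
  | RAdd r u v => set_rvar s r (rvar s u + rvar s v)
  | RSub r u v => set_rvar s r (rvar s u - rvar s v)
  | RMul r u v => set_rvar s r (rvar s u * rvar s v)
  | RDiv r u v => set_rvar s r (rvar s u / rvar s v)
  | RLoad r a i => set_rvar s r (rarr s a (nvar s i))
  | RStore a i r => set_rarr s a (nvar s i) (rvar s r)
  | Query r x y => set_rvar s r (entry A (nvar s x) (nvar s y))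
  | Seq c1 c2 => run c2 (run c1 s)
  | _ => s
  end.

Fixpoint run_queries c : nat :=
  match c with
  | Query _ _ _ => 1
  | Seq c1 c2 => run_queries c1 + run_queries c2
  | _ => 0
  end.

Fixpoint run_time c : nat :=
  match c with Seq c1 c2 => run_time c1 + run_time c2 | _ => 1 end.

Lemma exec_run c s : loopfree c -> exec A c s (run c s) (run_queries c) (run_time c).
Proof.
elim: c s => //=; try by intros; constructor.
by move=> c1 IH1 c2 IH2 s /andP[/IH1 E1 /IH2 E2]; apply: ESeq (E1 _) (E2 _).
Qed.

Lemma triple_run P Q c :
  loopfree c -> (forall s, P s -> Q (run c s)) ->
  triple P c Q (run_queries c) (run_time c).
Proof.
by move=> lf PQ s Ps; exists (run c s), (run_queries c), (run_time c); split; rewrite ?leqnn //;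
  [exact: exec_run | exact: PQ].
Qed.
End Hoare.

(* Code of the test *)
Infix ";;" := Seq (at level 90, right associativity).

(* Integer scalars: 0 = n, 1 = number of samples, 2 = 1, 4 = sample counter, 5 and 6 = row and column,
   7 = number K of rounds, 8 = basis vector, 9 = round counter, 10 = coordinate counter.
   Real scalars: 0 = eps, 1 and 2 = temporaries, 3 = 1, 4 = 1 + eps/8, 5 = 1 + eps/16, 6 and 7 = the
   quantities compared to find K, 8 = 4n, 9 = trace, 10 = 0. Real arrays: 0 = S, 1 = A o S / (4n),
   2 and 3 = current and next vector. *)
Definition prelude : com :=
  NConst 2 1;; ROfNat 3 2;; NAdd 5 0 0;; NAdd 5 5 5;; ROfNat 8 5.

Definition read_body : com :=
  NLoad 5 0 4;; NLoad 6 1 4;; Query 1 5 6;; RLoad 2 0 4;; RMul 1 1 2;; RDiv 1 1 8;;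
  RStore 1 4 1;; NAdd 4 4 2.

(* Real scalar 7 starts at 2n rather than n, so that the trace stays strictly below it in the
   positive semidefinite case. *)
Definition rates : com :=
  NAdd 5 0 0;; ROfNat 7 5;; ROfNat 6 2;; NConst 5 16;; ROfNat 1 5;; RDiv 1 0 1;;
  RAdd 5 3 1;; RAdd 4 5 1.

Definition count_body : com := RMul 6 6 4;; RMul 7 7 5;; NAdd 7 7 2.

Definition clear_body : com := RStore 2 10 10;; NAdd 10 10 2.

Definition copy_body (src dst : nat) : com := RLoad 1 src 10;; RStore dst 10 1;; NAdd 10 10 2.

(** Array 3 starts as a copy of the vector in array 2 and loses the contribution of one sample at a
    time, so a matrix-vector product costs O(n + m) rather than O(n^2). *)
Definition update_body : com :=
  NLoad 5 0 4;; NLoad 6 1 4;; RLoad 1 2 6;; RLoad 2 1 4;; RMul 1 1 2;; RLoad 2 3 5;;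
  RSub 1 2 1;; RStore 3 5 1;; NAdd 4 4 2.

Definition step_body : com :=
  NConst 10 0;; While (TNlt 10 0) (copy_body 2 3);;
  NConst 4 0;; While (TNlt 4 1) update_body;;
  NConst 10 0;; While (TNlt 10 0) (copy_body 3 2);;
  NAdd 9 9 2.

Definition trace_body : com :=
  NConst 10 0;; While (TNlt 10 0) clear_body;; (RStore 2 8 3;; NConst 9 0);;
  While (TNlt 9 7) step_body;;
  (RLoad 1 2 8;; RAdd 9 9 1;; NAdd 8 8 2).

(** Only [read_body] queries the matrix, once per sample; the stored products serve all later
    rounds. *)
Definition power_trace_test : com :=
  prelude;; While (TNlt 4 1) read_body;;
  rates;; While (TRlt 6 7) count_body;;
  While (TNlt 8 0) trace_body;;
  If (TRlt 9 7) (NConst 0 1) (NConst 0 0).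

(** * Verification of the program *)

Section Correctness.
Variables (R : realType) (n : nat) (A : 'M[R]_n) (eps : R).
Variables (m : nat) (rows cols : nat -> nat) (vals : nat -> R) (K : nat).
Hypothesis cols_lt : forall l, (l < m)%N -> (cols l < n)%N.

(** The shape of 4n that the two doublings in [prelude] produce. *)
Let scale : R := (n + n + (n + n))%N%:R.
Let ent l : R := entry A (rows l) (cols l) * vals l / scale.
Let rate : R := 1 + eps / 16%:R.
Let rate2 : R := rate + eps / 16%:R.

(** Minimality of K makes the counting loop, which stops at the first success, run exactly K
    times. *)
Hypothesis K_min : forall j, (j < K)%N -> rate2 ^+ j < (n + n)%N%:R * rate ^+ j.
Hypothesis K_ge : (n + n)%N%:R * rate ^+ K <= rate2 ^+ K.

Definition vstep (v : nat -> R) : nat -> R :=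
  fun j => v j - \sum_(0 <= l < m | rows l == j) v (cols l) * ent l.

Definition power_vec (k i : nat) : nat -> R := iter k vstep (fun j => (j == i)%:R).

Record base (s : state R) : Prop := Base {
  base0 : nvar s 0 = n; base1 : nvar s 1 = m; base2 : nvar s 2 = 1%N;
  base_rows : narr s 0 = rows; base_cols : narr s 1 = cols;
  base_eps : rvar s 0 = eps; base_one : rvar s 3 = 1; base_zero : rvar s 10 = 0;
  base_vals : rarr s 0 = vals }.

Definition read_inv p (s : state R) :=
  [/\ base s, nvar s 4 = p, rvar s 8 = scale /\ rvar s 9 = 0, nvar s 7 = 0%N /\ nvar s 8 = 0%N &
      forall l, (l < p)%N -> rarr s 1 l = ent l].

Lemma triple_read :
  triple A (read_inv 0) (While (TNlt 4 1) read_body) (read_inv m) (m * 1) (m * 9).+1.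
Proof.
apply: triple_while => [i s _ [bs i4 _ _ _]|i i_lt]; first by rewrite /= i4 (base1 bs).
apply: (@triple_run _ _ _ _ _ read_body) => // s.
case=> [[? ? b2 brows bcols ? ? ? bvals] i4 [s8 s9] [? ?] ents].
split => //=.
  by rewrite /upd /= i4 b2 addn1.
move=> l; rewrite ltnS /upd /= i4 => l_le; case: eqP => [->|/eqP l_neq].
  by rewrite brows bcols bvals s8.
by apply: ents; rewrite ltn_neqAle l_neq.
Qed.

Definition count_inv k (s : state R) :=
  [/\ base s, nvar s 7 = k /\ nvar s 8 = 0%N, rvar s 4 = rate2 /\ rvar s 5 = rate,
      rvar s 9 = 0 /\ rvar s 6 = rate2 ^+ k /\ rvar s 7 = (n + n)%N%:R * rate ^+ k &
      forall l, (l < m)%N -> rarr s 1 l = ent l].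

Lemma triple_count :
  triple A (count_inv 0) (While (TRlt 6 7) count_body) (count_inv K) (K * 0) (K * 4).+1.
Proof.
apply: triple_while => [i s iK [_ _ _ [_ [s6 s7]] _]|i i_lt].
  rewrite /= s6 s7; case: ltnP => [/K_min //|K_le].
  by have -> : i = K by [apply/eqP; rewrite eqn_leq iK]; rewrite ltNge K_ge.
apply: (@triple_run _ _ _ _ _ count_body) => // s.
case=> [[? ? b2 ? ? ? ? ? ?] [s7 ?] [s4 s5] [? [s6 r7]] ?].
split => //=.
  by rewrite /upd /= s7 b2 addn1.
by rewrite /upd /= s6 s4 s5 r7 !exprSr mulrA.
Qed.

(** Facts that every loop of the trace computation preserves; Q holds what varies. *)
Definition work (Q : state R -> Prop) (s : state R) :=
  [/\ base s, nvar s 7 = K, rvar s 7 = (n + n)%N%:R * rate ^+ K,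
      forall l, (l < m)%N -> rarr s 1 l = ent l & Q s].

Definition has_vec (a : nat) (v : nat -> R) (s : state R) :=
  forall j, (j < n)%N -> rarr s a j = v j.

Definition trace_inv i :=
  work (fun s => nvar s 8 = i /\ rvar s 9 = \sum_(0 <= j < i) power_vec K j j).

Definition outer_work i (Q : state R -> Prop) :=
  work (fun s => [/\ (i < n)%N, nvar s 8 = i, rvar s 9 = \sum_(0 <= j < i) power_vec K j j & Q s]).

Lemma triple_clear i :
  triple A (outer_work i (fun s => nvar s 10 = 0%N))
    (While (TNlt 10 0) clear_body) (outer_work i (has_vec 2 (fun=> 0))) 0 (n * 3).+1.
Proof.
pose Inv p := outer_work i (fun s => nvar s 10 = p /\ forall j, (j < p)%N -> rarr s 2 j = 0).
apply: (@triple_weaken _ _ _ (Inv 0%N) _ (Inv n) _ _ (n * 0) _ (n * 3).+1 _ _) => //.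
- apply: (@triple_while _ _ _ Inv _ _ n 0 2) => [j s _ [bs _ _ _ [_ _ _ [s10 _]]]|j j_lt].
    by rewrite /= s10 (base0 bs).
  apply: (@triple_run _ _ _ _ _ clear_body) => // s.
  case=> [[? ? b2 ? ? ? ? b10 ?] ? ? ? [? ? ? [s10 v0]]].
  split=> //=.
  split=> //; rewrite /upd /= s10 b2 addn1; split=> // l; rewrite ltnS => l_le.
  by case: eqP => // /eqP l_neq; apply: v0; rewrite ltn_neqAle l_neq.
- by move=> s [? ? ? ? [? ? ? ?]]; split.
- by move=> s [? ? ? ? [? ? ? [? ?]]]; split.
by rewrite muln0.
Qed.

Definition iter_work i k (Q : state R -> Prop) :=
  outer_work i (fun s => [/\ (k < K)%N, nvar s 9 = k & Q s]).

(** One proof for both directions between arrays 2 and 3; the side condition protects arrays 0 and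
    1, which hold the sample data. *)
Lemma triple_copy i k (src dst : nat) v :
  (src == 2%N) && (dst == 3%N) || (src == 3%N) && (dst == 2%N) ->
  triple A (iter_work i k (fun s => nvar s 10 = 0%N /\ has_vec src v s))
    (While (TNlt 10 0) (copy_body src dst))
    (iter_work i k (fun s => has_vec src v s /\ has_vec dst v s)) 0 (n * 4).+1.
Proof.
move=> srcdst.
pose Inv p := iter_work i k (fun s => [/\ nvar s 10 = p, has_vec src v s &
  forall j, (j < p)%N -> rarr s dst j = v j]).
apply: (@triple_weaken _ _ _ (Inv 0%N) _ (Inv n) _ _ (n * 0) _ (n * 4).+1 _ _) => //.
- apply: (@triple_while _ _ _ Inv _ _ n 0 3) => [j s _ [bs _ _ _ [_ _ _ [_ _ [s10 _ _]]]]|j j_lt].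
    by rewrite /= s10 (base0 bs).
  apply: (@triple_run _ _ _ _ _ (copy_body src dst)) => // s.
  case=> [[? ? b2 ? ? ? ? b10 ?] ? ? ? [? ? ? [? ? [s10 vs vd]]]].
  have H l : (l < j.+1)%N -> upd (rarr s dst) (nvar s 10) (rarr s src (nvar s 10)) l = v l.
    rewrite ltnS /upd => l_le; case: eqP => [->|/eqP l_neq]; first by rewrite vs ?s10.
    by apply: vd; rewrite ltn_neqAle -{1}s10 l_neq.
  case/orP: srcdst => /andP[/eqP ? /eqP ?]; subst src dst.
  + split=> //=.
    by split=> //; split=> //; split=> //; rewrite /upd /= s10 b2 addn1.
  + split=> //=.
    by split=> //; split=> //; split=> //; rewrite /upd /= s10 b2 addn1.
- by move=> s [? ? ? ? [? ? ? [? ? [? ?]]]]; split.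
- by move=> s [? ? ? ? [? ? ? [? ? [? ? ?]]]]; split.
by rewrite muln0.
Qed.

(** [vstep] cut off after p samples, for the invariant of the update loop. *)
Definition partial_step p (v : nat -> R) : nat -> R :=
  fun j => v j - \sum_(0 <= l < p | rows l == j) v (cols l) * ent l.

Lemma triple_update i k v :
  triple A (iter_work i k (fun s => [/\ nvar s 4 = 0%N, has_vec 2 v s & has_vec 3 v s]))
    (While (TNlt 4 1) update_body)
    (iter_work i k (has_vec 3 (vstep v))) 0 (m * 10).+1.
Proof.
pose Inv p := iter_work i k (fun s =>
  [/\ nvar s 4 = p, has_vec 2 v s & has_vec 3 (partial_step p v) s]).
apply: (@triple_weaken _ _ _ (Inv 0%N) _ (Inv m) _ _ (m * 0) _ (m * 10).+1 _ _) => //.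
- apply: (@triple_while _ _ _ Inv _ _ m 0 9) => [j s _ [bs _ _ _ [_ _ _ [_ _ [s4 _ _]]]]|j j_lt].
    by rewrite /= s4 (base1 bs).
  apply: (@triple_run _ _ _ _ _ update_body) => // s.
  case=> [[? ? b2 brows bcols ? ? b10 ?] ? ? ents [? ? ? [? ? [s4 v2 v3]]]].
  split=> //=.
  split=> //; split=> //; rewrite /upd /= ?s4 ?b2 ?addn1 //.
  split=> // l l_lt; rewrite brows bcols /=.
  rewrite /partial_step big_mkcond big_nat_recr //= -big_mkcond opprD addrA.
  rewrite /upd /= [rows j == l]eq_sym; case: eqP => [lE|_]; last by rewrite subr0 v3.
  by rewrite -lE v3 // v2 ?cols_lt // ents.
- move=> s [? ? ? ? [? ? ? [? ? [? ? v3]]]]; split=> //; split=> //; split=> //; split=> //.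
  by move=> j j_lt; rewrite v3 // /partial_step big_geq ?subr0.
- by move=> s [? ? ? ? [? ? ? [? ? [? ?]]]]; split.
by rewrite muln0.
Qed.

Lemma triple_step i k v :
  triple A (iter_work i k (has_vec 2 v)) step_body
    (outer_work i (fun s => nvar s 9 = k.+1 /\ has_vec 2 (vstep v) s)) 0 (n * 8 + m * 10 + 7).
Proof.
apply: (@triple_weaken _ _ _ _ _ _ _ _ (0 + (0 + (0 + (0 + (0 + (0 + 0))))))
    _ (1 + ((n * 4).+1 + (1 + ((m * 10).+1 + (1 + ((n * 4).+1 + 1))))))
    _ _ (fun s => id) (fun s => id) _ _).
- apply: (triple_seq (Q := iter_work i k (fun s => nvar s 10 = 0%N /\ has_vec 2 v s))).
    apply: (@triple_run _ _ _ _ _ (NConst 10 0)) => // s.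
    by case=> [[? ? ? ? ? ? ? ? ?] ? ? ? [? ? ? [? ? ?]]]; split.
  apply: triple_seq; first exact: triple_copy.
  apply: (triple_seq (Q := iter_work i k (fun s => [/\ nvar s 4 = 0%N, has_vec 2 v s &
      has_vec 3 v s]))).
    apply: (@triple_run _ _ _ _ _ (NConst 4 0)) => // s.
    by case=> [[? ? ? ? ? ? ? ? ?] ? ? ? [? ? ? [? ? [? ?]]]]; split.
  apply: triple_seq; first exact: triple_update.
  apply: (triple_seq (Q := iter_work i k (fun s => nvar s 10 = 0%N /\ has_vec 3 (vstep v) s))).
    apply: (@triple_run _ _ _ _ _ (NConst 10 0)) => // s.
    by case=> [[? ? ? ? ? ? ? ? ?] ? ? ? [? ? ? [? ? ?]]]; split.
  apply: triple_seq; first exact: triple_copy.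
  apply: (@triple_run _ _ _ _ _ (NAdd 9 9 2)) => // s.
  case=> [[? ? b2 ? ? ? ? ? ?] ? ? ? [? ? ? [? s9 [? ?]]]]; split=> //=.
  by split=> //; split=> //; rewrite /upd /= s9 b2 addn1.
- by [].
by lia.
Qed.

Lemma triple_iterate i :
  triple A (outer_work i (fun s => nvar s 9 = 0%N /\ has_vec 2 (power_vec 0 i) s))
    (While (TNlt 9 7) step_body)
    (outer_work i (has_vec 2 (power_vec K i))) 0 (K * (n * 8 + m * 10 + 8)).+1.
Proof.
pose Inv k := outer_work i (fun s => nvar s 9 = k /\ has_vec 2 (power_vec k i) s).
apply: (@triple_weaken _ _ _ (Inv 0%N) _ (Inv K) _ _ (K * 0) _
    (K * (n * 8 + m * 10 + 7).+1).+1 _ _) => //.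
- apply: (@triple_while _ _ _ Inv _ _ K 0 (n * 8 + m * 10 + 7)) =>
    [k s _ [_ s7 _ _ [_ _ _ [s9 _]]]|k k_lt].
    by rewrite /= s9 s7.
  apply: (triple_weaken (@triple_step i k (power_vec k i))) => // s.
  by case=> [? ? ? ? [? ? ? [? ?]]]; split.
- by move=> s [? ? ? ? [? ? ? [? ?]]]; split.
- by rewrite muln0.
by rewrite -addnS.
Qed.

Lemma triple_trace_body i : (i < n)%N ->
  triple A (trace_inv i) trace_body (trace_inv i.+1) 0 (K * (n * 8 + m * 10 + 8) + n * 3 + 8).
Proof.
move=> i_lt.
apply: (@triple_weaken _ _ _ _ _ _ _ _ (0 + (0 + (0 + (0 + 0))))
    _ (1 + ((n * 3).+1 + (2 + ((K * (n * 8 + m * 10 + 8)).+1 + 3))))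
    _ _ (fun s => id) (fun s => id) _ _).
- apply: (triple_seq (Q := outer_work i (fun s => nvar s 10 = 0%N))).
    apply: (@triple_run _ _ _ _ _ (NConst 10 0)) => // s.
    by case=> [[? ? ? ? ? ? ? ? ?] ? ? ? [? ?]]; split.
  apply: triple_seq; first exact: triple_clear.
  apply: (triple_seq (Q := outer_work i (fun s => nvar s 9 = 0%N /\ has_vec 2 (power_vec 0 i) s))).
    apply: (@triple_run _ _ _ _ _ (RStore 2 8 3;; NConst 9 0)) => // s.
    case=> [[? ? ? ? ? ? b3 ? ?] ? ? ? [? s8 ? v0]]; split=> //=.
    split=> //; split=> // j j_lt; rewrite /= /upd /= s8 b3.
    by case: eqP => // _; rewrite v0.
  apply: triple_seq; first exact: triple_iterate.
  apply: (@triple_run _ _ _ _ _ (RLoad 1 2 8;; RAdd 9 9 1;; NAdd 8 8 2)) => // s.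
  case=> [[? ? b2 ? ? ? ? ? ?] ? ? ? [? s8 s9 vK]]; split=> //=.
  split; rewrite /upd /= s8 ?b2 ?addn1 // s9 big_nat_recr //=.
  by rewrite vK.
- by [].
by lia.
Qed.

Lemma exec_power_trace_test (s : state R) :
    (0 < n)%N ->
    nvar s 0 = n -> nvar s 1 = m -> nvar s 4 = 0%N -> nvar s 7 = 0%N -> nvar s 8 = 0%N ->
    narr s 0 = rows -> narr s 1 = cols ->
    rvar s 0 = eps -> rvar s 9 = 0 -> rvar s 10 = 0 -> rarr s 0 = vals ->
  exists s' q t, [/\ exec A power_trace_test s s' q t,
    output s' = (\sum_(0 <= j < n) power_vec K j j < (n + n)%N%:R * rate ^+ K),
    (q <= m)%N & (t <= 100 * (n * (K.+1 * (n + m).+1)))%N].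
Proof.
move=> n_gt0 s0 s1 s4 s7 s8 arr0 arr1 r0 r9 r10 rarr0.
have Hprelude : triple A (fun s' => s' = s) prelude (read_inv 0) 0 5.
  apply: (@triple_run _ _ _ _ _ prelude) => // _ ->; split=> //=.
  by rewrite /upd /= s0.
have Hrates : triple A (read_inv m) rates (count_inv 0) 0 8.
  apply: (@triple_run _ _ _ _ _ rates) => // s'.
  case=> [[b0 b1 b2 ? ? b6 b7 ? ?] i4 [s'8 s'9] [? ?] ?]; split=> //=.
    by rewrite /upd /= b6 b7.
  by rewrite /upd /= b0 b2 mulr1.
have Htrace : triple A (trace_inv 0) (While (TNlt 8 0) trace_body) (trace_inv n) (n * 0)
    (n * (K * (n * 8 + m * 10 + 8) + n * 3 + 8).+1).+1.
  apply: triple_while => [i s' _ [bs' _ _ _ [s'8 _]]|i]; last exact: triple_trace_body.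
  by rewrite /= s'8 (base0 bs').
have Hcount : triple A (count_inv 0) (While (TRlt 6 7) count_body) (trace_inv 0) (K * 0) (K * 4).+1.
  apply: (triple_weaken triple_count) => // s' [? [? ?] ? [? [? ?]] ?]; split=> //.
  by split=> //; rewrite big_geq.
have Hfinal : triple A (trace_inv n) (If (TRlt 9 7) (NConst 0 1) (NConst 0 0))
    (fun s' => output s' =
      (\sum_(0 <= j < n) power_vec K j j < (n + n)%N%:R * rate ^+ K)) 0 2.
  move=> s' [_ _ r7 _ [_ <-]]; rewrite -r7.
  exists (set_nvar s' 0 (rvar s' 9 < rvar s' 7)%R), 0%N, 2%N; split=> //.
  by case: (boolP (rvar s' 9 < rvar s' 7)) => cmp;
    [apply: EIfTrue => //|apply: EIfFalse => //]; exact: ENConst.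
have [s' [q [t [E ? q_le t_le]]]] := triple_seq Hprelude (triple_seq triple_read
  (triple_seq Hrates (triple_seq Hcount (triple_seq Htrace Hfinal)))) erefl.
exists s', q, t; split=> //; first by apply: leq_trans q_le _; rewrite !muln0 muln1; lia.
apply: leq_trans t_le _.
(* The dominant term: n basis vectors, K rounds each, O(n + m) per round. The factor 100 absorbs the
   other phases. *)
have : (n * (K * (n * 8 + m * 10 + 8)) <= 10 * (n * (K * (n + m).+1)))%N.
  rewrite (mulnCA 10) leq_mul2l (mulnCA 10) leq_mul2l; apply/orP; right; apply/orP; right; lia.
have : (n * n <= n * (n + m).+1)%N by rewrite leq_mul2l; apply/orP; right; lia.
have : (K <= n * (K * (n + m).+1))%N by rewrite mulnCA leq_pmulr // muln_gt0 n_gt0.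
have : (m.+1 <= n * (n + m).+1)%N by apply: leq_trans (leq_pmull _ n_gt0); lia.
have : (n <= n * n)%N by rewrite leq_pmulr.
have -> : (n * (K.+1 * (n + m).+1) = n * (n + m).+1 + n * (K * (n + m).+1))%N
  by rewrite mulSn mulnDr.
have -> : (n * (K * (n * 8 + m * 10 + 8) + n * 3 + 8).+1 =
  n * (K * (n * 8 + m * 10 + 8)) + 3 * (n * n) + 9 * n)%N by ring.
move: (n * (K * (n * 8 + m * 10 + 8)))%N (n * (K * (n + m).+1))%N => X Y.
by move: (n * (n + m).+1)%N (n * n)%N => Z W; lia.
Qed.
End Correctness.

(** * Spectral gap and complexity bounds *)

Section PowerTrace.
Variables (R : realFieldType) (n : nat) (U M : 'M[R]_n) (mu : 'rV[R]_n).
Hypothesis UU : U *m U^T = 1%:M.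
Hypothesis ME : M = U^T *m diag_mx mu *m U.

Lemma iter_mulmx_diagonalization k :
  iter k (mulmx M) 1%:M = U^T *m diag_mx (\row_i mu 0 i ^+ k) *m U.
Proof.
elim: k => [|k IHk].
  have -> : \row_i mu 0 i ^+ 0 = const_mx 1 by apply/rowP => i; rewrite !mxE expr0.
  by rewrite /= diag_const_mx mulmx1 mulmx1C.
rewrite iterS IHk ME !mulmxA -[_ *m U *m U^T]mulmxA UU mulmx1 -[_ *m diag_mx mu *m _]mulmxA.
rewrite mulmx_diag; congr (_ *m diag_mx _ *m _); apply/rowP => i.
by rewrite !mxE exprS.
Qed.

Lemma mxtrace_iter_mulmx k : \tr (iter k (mulmx M) 1%:M) = \sum_i mu 0 i ^+ k.
Proof.
rewrite iter_mulmx_diagonalization mxtrace_mulC mulmxA UU mul1mx mxtrace_diag.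
by apply: eq_bigr => i _; rewrite mxE.
Qed.

Definition qform (W : 'M[R]_n) (x : 'I_n -> R) : R := \sum_j \sum_k x j * W j k * x k.

Lemma qform_diagonalization x :
  qform M x = \sum_i mu 0 i * (\sum_j U i j * x j) ^+ 2.
Proof.
rewrite /qform; under eq_bigr => j _ do under eq_bigr => k _ do
  rewrite (entry_diagonalization ME) mulr_sumr mulr_suml.
under eq_bigr do rewrite exchange_big.
rewrite exchange_big; apply: eq_bigr => i _ /=.
rewrite expr2 mulr_suml mulr_sumr; apply: eq_bigr => j _.
by rewrite !mulr_sumr; apply: eq_bigr => k _; ring.
Qed.

Lemma sum_sqr_coord x : \sum_i (\sum_j U i j * x j) ^+ 2 = \sum_j x j ^+ 2.
Proof.
have UtU := mulmx1C UU.
under eq_bigr do rewrite expr2 mulr_suml; rewrite exchange_big; apply: eq_bigr => j _ /=.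
under eq_bigr do rewrite mulr_sumr; rewrite exchange_big /=.
have E k : \sum_i U i j * U i k = (j == k)%:R.
  have /matrixP/(_ j k) := UtU; rewrite !mxE => <-.
  by apply: eq_bigr => i _; rewrite mxE.
under eq_bigr => k _.
  have -> : \sum_i U i j * x j * (U i k * x k) = x j * x k * (j == k)%:R.
    by rewrite -E mulr_sumr; apply: eq_bigr => i _; ring.
  over.
rewrite (bigD1 j) //= eqxx mulr1 big1 ?addr0 ?expr2 // => k kj.
by rewrite eq_sym (negPf kj) mulr0.
Qed.

Lemma qform_row i : qform M (U i) = mu 0 i.
Proof.
rewrite qform_diagonalization (bigD1 i) //= [X in _ + X]big1 => [|k ki].
    rewrite [\sum_j _](_ : _ = 1) ?expr1n ?mulr1 ?addr0 //.
  by rewrite -(sum_sqr_row UU i); apply: eq_bigr => j _; rewrite expr2.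
rewrite [\sum_j _](_ : _ = 0) ?expr0n ?mulr0 //.
have /matrixP/(_ k i) := UU; rewrite !mxE (negPf ki) => E; apply: etrans E.
by apply: eq_bigr => j _; rewrite mxE.
Qed.
End PowerTrace.

(** * The program's vectors as columns of matrix powers *)

Section SampledMatrix.
Variables (R : realType) (n : nat) (A S : 'M[R]_n).
Hypothesis n_gt0 : (0 < n)%N.

Let s := supp S.
Let rows := nth 0%N [seq val p.1 | p <- s].
Let cols := nth 0%N [seq val p.2 | p <- s].
Let vals := nth 0 [seq S p.1 p.2 | p <- s].

Definition sampled : 'M[R]_n := \matrix_(i, j) (A i j * S i j).

Definition shifted : 'M[R]_n := 1%:M - (n + n + (n + n))%N%:R^-1 *: sampled.

(** Entries outside the support of S vanish in the product, so the sum over the sample list is a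
    full row sum. *)
Lemma vstep_shifted (v : nat -> R) (j : 'I_n) :
  vstep A (size s) rows cols vals v j = v j -
    (n + n + (n + n))%N%:R^-1 * \sum_k sampled j k * v k.
Proof.
rewrite /vstep; congr (_ - _).
pose p0 : 'I_n * 'I_n := (Ordinal n_gt0, Ordinal n_gt0).
pose F (p : 'I_n * 'I_n) : R := v p.2 * (A p.1 p.2 * S p.1 p.2 / (n + n + (n + n))%N%:R).
have entE (a b : 'I_n) : entry A a b = A a b by rewrite /entry !valK.
have -> : \sum_(0 <= l < size s | rows l == j) v (cols l) *
      (entry A (rows l) (cols l) * vals l / (n + n + (n + n))%N%:R) =
    \sum_(p <- s | p.1 == j) F p.
  rewrite (big_nth p0) [LHS]big_nat_cond [RHS]big_nat_cond.
  have nthE l : (l < size s)%N -> [/\ rows l = (nth p0 s l).1, cols l = (nth p0 s l).2 &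
      vals l = S (nth p0 s l).1 (nth p0 s l).2].
    by move=> l_lt; rewrite /rows /cols /vals !(nth_map p0).
  apply: eq_big => [l|l Hl].
    case l_lt: (l < size s)%N; last by rewrite !andbF.
    by have [-> _ _] := nthE l l_lt.
  have l_lt : (l < size s)%N by move: Hl; case: (l < size s)%N.
  by have [-> -> ->] := nthE l l_lt; rewrite entE.
rewrite big_filter_cond big_enum_cond /= mulr_sumr.
rewrite (eq_bigl (fun p => (p.1 == j) && (S p.1 p.2 != 0))) => [|p]; last by rewrite andbC.
rewrite big_mkcondr /=.
transitivity (\sum_(p | (pred1 j p.1) && xpredT p.2)
    (fun a b => if S a b != 0 then F (a, b) else 0) p.1 p.2).
  by apply: eq_big => [p|[a b] _ //]; rewrite /= andbT.
rewrite -(pair_big (pred1 j) xpredT (fun a b => if S a b != 0 then F (a, b) else 0)) /=.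
rewrite big_pred1_eq; apply: eq_bigr => k _; rewrite mxE /F /=.
by case: eqP => [->|_] /=; rewrite ?mulr0 ?mul0r ?mulr0 // mulrA mulrC;
  congr (_ * _); rewrite mulrC.
Qed.

Lemma power_vec_shifted k (i j : 'I_n) :
  power_vec A (size s) rows cols vals k i j = iter k (mulmx shifted) 1%:M j i.
Proof.
elim: k j => [|k IHk] j; first by rewrite mxE.
rewrite /power_vec iterS vstep_shifted -!/(power_vec _ _ _ _ _ _ _) IHk /=.
rewrite /shifted mulmxBl mul1mx -scalemxAl !mxE; congr (_ - _ * _).
by apply: eq_bigr => l _; rewrite [_ j l]mxE IHk.
Qed.

Lemma trace_power_vec k :
  \sum_(0 <= j < n) power_vec A (size s) rows cols vals k j j =
  \tr (iter k (mulmx shifted) 1%:M).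
Proof. by rewrite big_mkord; apply: eq_bigr => j _; rewrite power_vec_shifted. Qed.
End SampledMatrix.

(** * Separation of the two cases by the trace *)

Section Decision.
Variables (R : realType) (n : nat) (A S : 'M[R]_n) (eps gamma : R) (L : nat).
Hypothesis n_gt0 : (0 < n)%N.
Hypothesis eps_gt0 : 0 < eps.
Hypothesis eps_lt1 : eps < 1.
Hypothesis symA : A^T = A.
Hypothesis A_bounded : bounded_entries A.
Hypothesis symS : S^T = S.
Hypothesis S_ge0 : forall i j, 0 <= S i j.
Hypothesis gamma_gt0 : 0 < gamma.
Hypothesis gammaE : 10 * L.+1%:R * gamma = eps / 4.
Hypothesis S_expander : forall (p q : 'I_n -> R) t, 0 < t ->
  `|\sum_i \sum_j p i * (S i j - 1) * q j| <=
    gamma ^+ 2 * n%:R * (t * (\sum_i p i ^+ 2) + t^-1 * \sum_i q i ^+ 2).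
Hypothesis n_le4L : (n <= 4 ^ L)%N.

Let W : 'M[R]_n := \matrix_(j, k) (A j k * (S j k - 1)).

Lemma gamma_le1 : gamma <= 1.
Proof.
have L1 : 1 <= L.+1%:R :> R by rewrite ler1n.
have : 10 * 1 * gamma <= 10 * L.+1%:R * gamma by rewrite !ler_pM2r // ler_pM2l.
rewrite gammaE mulr1; move: eps_gt0 eps_lt1 gamma_gt0; lra.
Qed.

Lemma qform_sampledE x : qform (sampled A S) x = qform A x + qform W x.
Proof.
rewrite /qform -big_split; apply: eq_bigr => j _; rewrite -big_split.
by apply: eq_bigr => k _; rewrite !mxE /=; ring.
Qed.

(** Bounded entries reduce this to the form of J + (S - J) at |x|, at most n + 2 gamma^2 n <= 3n
    times the squared norm. It makes the eigenvalues of [shifted] nonnegative, so that a single one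
    bounds the trace of a power from below. *)
Lemma qform_sampled_le x : qform (sampled A S) x <= 4 * n%:R * \sum_j x j ^+ 2.
Proof.
have abs2 : \sum_j `|x j| ^+ 2 = \sum_j x j ^+ 2.
  by apply: eq_bigr => j _; rewrite real_normK ?num_real.
have ES := S_expander (fun j => `|x j|) (fun j => `|x j|) ltr01.
rewrite invr1 !mul1r abs2 in ES; have {ES} := le_trans (ler_norm _) ES.
have CS := sqr_sum_le_card xpredT (fun j : 'I_n => `|x j|).
rewrite abs2 card_ord in CS.
have nx_ge0 : 0 <= n%:R * \sum_j x j ^+ 2 :> R.
  by rewrite mulr_ge0 ?ler0n // sumr_ge0 // => j _; rewrite sqr_ge0.
have : gamma ^+ 2 * n%:R * (\sum_j x j ^+ 2 + \sum_j x j ^+ 2) <=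
    2 * (n%:R * \sum_j x j ^+ 2).
  have -> : gamma ^+ 2 * n%:R * (\sum_j x j ^+ 2 + \sum_j x j ^+ 2) =
      gamma ^+ 2 * (2 * (n%:R * \sum_j x j ^+ 2)) by ring.
  apply: ler_piMl; first exact: mulr_ge0.
  by apply: exprn_ile1; rewrite ?gamma_le1 // ltW.
have : qform (sampled A S) x <= (\sum_j `|x j|) ^+ 2 +
    \sum_i \sum_j `|x i| * (S i j - 1) * `|x j|.
  rewrite expr2 mulr_suml -big_split; apply: ler_sum => j _ /=.
  rewrite mulr_sumr -big_split; apply: ler_sum => k _ /=.
  apply: le_trans (ler_norm _) _; rewrite mxE !normrM (ger0_norm (S_ge0 j k)).
  have -> : `|x j| * `|x k| + `|x j| * (S j k - 1) * `|x k| =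
    `|x j| * (1 * S j k) * `|x k| by ring.
  by rewrite ler_wpM2r // ler_wpM2l // ler_wpM2r // A_bounded.
move: nx_ge0 CS; lra.
Qed.

Lemma sampled_sym : (sampled A S)^T = sampled A S.
Proof.
apply/matrixP => i j; rewrite !mxE.
have /matrixP/(_ i j) := symA; have /matrixP/(_ i j) := symS.
by rewrite !mxE => -> ->.
Qed.

Let scale : R := (n + n + (n + n))%N%:R.

Lemma scaleE : scale = 4 * n%:R.
Proof. by rewrite /scale !natrD; ring. Qed.

Lemma qform_shifted x :
  qform (shifted A S) x = \sum_j x j ^+ 2 - scale^-1 * qform (sampled A S) x.
Proof.
rewrite /qform mulr_sumr -sumrB; apply: eq_bigr => j _.
rewrite mulr_sumr (bigD1 j) //= [X in _ - X](bigD1 j) //= opprD addrA.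
rewrite -sumrN.
have -> : x j * shifted A S j j * x j = x j ^+ 2 - scale^-1 * (x j * sampled A S j j * x j).
  by rewrite !mxE eqxx mulr1n -/scale; ring.
congr (_ + _); apply: eq_bigr => k kj.
by rewrite !mxE eq_sym (negPf kj) mulr0n -/scale; ring.
Qed.

Lemma shifted_sym : (shifted A S)^T = shifted A S.
Proof. by rewrite /shifted linearB linearZ /= trmx1 sampled_sym. Qed.

Lemma trace_gap :
  (0 <= (eigvals A)`_n.-1 ->
    forall k, \tr (iter k (mulmx (shifted A S)) 1%:M) <= n%:R * (1 + eps / 16) ^+ k) /\
  ((eigvals A)`_n.-1 <= - (eps * Num.max n%:R (nuclear_norm A)) ->
    forall k, (1 + eps / 16 + eps / 16) ^+ k <= \tr (iter k (mulmx (shifted A S)) 1%:M)).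
Proof.
have [U [d [UU AE]]] := symmetric_diagonalization symA.
have [V [mu [VV ME]]] := symmetric_diagonalization shifted_sym.
have [i0 lastE d_min] := last_eigval d UU n_gt0; rewrite -AE in lastE.
have nucE := nuclear_norm_diagonalization d UU; rewrite -AE in nucE.
have n0 : 0 < n%:R :> R by rewrite ltr0n.
have scale_gt0 : 0 < scale by rewrite scaleE mulr_gt0.
have qW M x : n%:R <= M -> \sum_i `|d 0 i| <= M ->
    `|qform W x| <= eps / 4 * M * \sum_j x j ^+ 2.
  move=> nM dM; rewrite -gammaE.
  have := universal_sparsifier UU AE A_bounded S_ge0 gamma_gt0 gamma_le1
    S_expander nM dM n_le4L x.
  rewrite /qform; under [in X in _ -> X]eq_bigr => j _ do under eq_bigr => k _ do rewrite mxE.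
  by [].
have muE i : mu 0 i = 1 - scale^-1 * qform (sampled A S) (V i).
  by rewrite -(qform_row VV ME) qform_shifted (sum_sqr_row VV).
have mu_ge0 i : 0 <= mu 0 i.
  rewrite muE subr_ge0 ler_pdivrMl // mulr1 scaleE.
  by have := qform_sampled_le (V i); rewrite (sum_sqr_row VV) mulr1.
split=> [|] + k; rewrite (mxtrace_iter_mulmx VV ME) lastE.
  move=> d0_ge0; have d_ge0 i := le_trans d0_ge0 (d_min i).
  (* For a positive semidefinite A the nuclear norm is the trace, at most n, so the sparsifier
     applies with M = n. *)
  have nuc_le : \sum_i `|d 0 i| <= n%:R.
    have -> : \sum_i `|d 0 i| = \tr A.
      rewrite AE mxtrace_mulC mulmxA UU mul1mx mxtrace_diag.
      by apply: eq_bigr => i _; rewrite ger0_norm.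
    rewrite -[n in leRHS]card_ord -sumr_const; apply: ler_sum => i _.
    exact: le_trans (ler_norm _) (A_bounded i i).
  rewrite -[n in leRHS]card_ord mulr_natl -sumr_const; apply: ler_sum => i _.
  apply: lerXn2r; rewrite ?nnegrE //; first by have := eps_gt0; lra.
  have := qW n%:R (V i) (lexx _) nuc_le; rewrite (sum_sqr_row VV) mulr1.
  rewrite ler_norml => /andP[lo _]; rewrite muE lerD2l -mulrN ler_pdivrMl // scaleE.
  have : 0 <= qform A (V i).
    rewrite (qform_diagonalization AE); apply: sumr_ge0 => j _.
    by rewrite mulr_ge0 ?sqr_ge0.
  rewrite qform_sampledE; have -> : 4 * n%:R * (eps / 16) = eps / 4 * n%:R by field.
  by lra.
rewrite nucE => d_le.
set M := Num.max _ _ in d_le.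
have nM : n%:R <= M by rewrite le_max lexx.
have dM : \sum_i `|d 0 i| <= M by rewrite le_max lexx orbT.
have := qW M (U i0) nM dM; rewrite (sum_sqr_row UU) mulr1 ler_norml => /andP[_ hi].
(* The test vector is an eigenvector of A for lambda_n. Its form exceeds 1 by at least (eps - eps/4)
   M / (4n) >= 3 eps / 16, above the threshold eps / 8. *)
have gap : 1 + eps / 16 + eps / 16 < qform (shifted A S) (U i0).
  rewrite qform_shifted (sum_sqr_row UU) qform_sampledE (qform_row UU AE).
  rewrite -addrA ltrD2l -mulrN ltr_pdivlMl // scaleE.
  have epsn : eps * n%:R <= eps * M by rewrite ler_pM2l.
  have epsn_gt0 : 0 < eps * n%:R by rewrite mulr_gt0.
  have -> : 4 * n%:R * (eps / 16 + eps / 16) = eps * n%:R / 2 by field.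
  have : qform W (U i0) <= eps * M / 4 by rewrite (_ : _ / 4 = eps / 4 * M) //; field.
  by lra.
(* Otherwise no Rayleigh quotient could exceed the threshold either. *)
have [i mu_i] : exists i, 1 + eps / 16 + eps / 16 < mu 0 i.
  apply/existsP; apply: contraLR gap => /existsPn mu_le.
  rewrite -leNgt (qform_diagonalization ME).
  apply: (@le_trans _ _ (\sum_i (1 + eps / 16 + eps / 16) * (\sum_j V i j * U i0 j) ^+ 2)).
    by apply: ler_sum => i _; rewrite ler_wpM2r ?sqr_ge0 // leNgt.
  by rewrite -mulr_sumr (sum_sqr_coord VV) (sum_sqr_row UU) mulr1.
apply: (@le_trans _ _ (mu 0 i ^+ k)).
  by apply: lerXn2r; rewrite ?nnegrE ?(ltW mu_i) //; have := eps_gt0; lra.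
by rewrite (bigD1 i) //= lerDl sumr_ge0 // => j _; rewrite exprn_ge0.
Qed.
End Decision.

(** * Logarithms, number of rounds and choice of the sampling matrix *)

Lemma trunc_log_le_ln (R : realType) (n : nat) : (0 < n)%N ->
  (trunc_log 2 n).+1%:R <= 2 * (1 + ln n%:R) :> R.
Proof.
move=> n_gt0; have /andP[lo _] : (2 ^ trunc_log 2 n <= n < 2 ^ (trunc_log 2 n).+1)%N.
  exact: trunc_log_bounds.
(* From ln (1 + x) <= x at x = -1/2. *)
have ln2 : 2^-1 <= ln 2 :> R.
  have E : 1 - 2^-1 = 2^-1 :> R by field.
  by have := @le_ln1Dx R (- 2^-1); rewrite E lnV ?posrE // lerN2;
    apply; rewrite ltrN2 invf_lt1 // ltr1n.
have : ln (2 ^+ trunc_log 2 n) <= ln n%:R :> R.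
  by rewrite ler_ln ?posrE ?exprn_gt0 ?ltr0n // -natrX ler_nat.
rewrite lnXn // -(mulr_natr (ln 2)) => H.
have := ler_wpM2r (ler0n R (trunc_log 2 n)) ln2.
by rewrite -[(trunc_log 2 n).+1]addn1 natrD; move: H; lra.
Qed.

(** The two rates have ratio at least 1 + eps/17, because 1 + eps/16 <= 17/16. By Bernoulli, N >
    17/eps factors of it reach 2, and l + 1 doublings reach 2n. *)
Lemma exists_rounds (R : realType) (n : nat) (eps : R) :
    (0 < n)%N -> 0 < eps -> eps < 1 ->
  exists K : nat,
    [/\ forall j, (j < K)%N ->
          (1 + eps / 16 + eps / 16) ^+ j < (n + n)%N%:R * (1 + eps / 16) ^+ j,
        (n + n)%N%:R * (1 + eps / 16) ^+ K <= (1 + eps / 16 + eps / 16) ^+ K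
      & K.+1%:R <= 37 * (trunc_log 2 n).+1%:R / eps].
Proof.
move=> n_gt0 eps_gt0 eps_lt1; set l := (trunc_log 2 n).+1.
have /andP[_ n_lt] : (2 ^ trunc_log 2 n <= n < 2 ^ l)%N by exact: trunc_log_bounds.
pose N := (Num.truncn (17 / eps)).+1.
have q_ge0 : 0 <= 17 / eps by rewrite divr_ge0 // ltW.
have /andP[N_le N_gt] := truncn_itv q_ge0.
pose r := 1 + eps / 16; pose r2 := r + eps / 16.
have r_gt0 : 0 < r by rewrite /r; lra.
have double : 2 <= (1 + eps / 17) ^+ N.
  have e17 : 0 <= eps / 17 by lra.
  have bern k : 1 + k%:R * (eps / 17) <= (1 + eps / 17) ^+ k.
    elim: k => [|k IHk]; first by rewrite mul0r addr0 expr0.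
    rewrite exprS -[k.+1]addn1 natrD.
    have := ler0n R k; have := ler_wpM2l (_ : 0 <= 1 + eps / 17) IHk.
    move=> /(_ ltac:(lra)); nra.
  apply: le_trans (bern N); rewrite -lerBlDl.
  have -> : 2 - 1 = (17 / eps) * (eps / 17) :> R by field; rewrite gt_eqF.
  by rewrite ler_wpM2r // ltW.
have r2_ge : r * (1 + eps / 17) <= r2 by rewrite /r2 /r; nra.
have K0 : (n + n)%N%:R * r ^+ (N * l.+1) <= r2 ^+ (N * l.+1).
  apply: (@le_trans _ _ ((r * (1 + eps / 17)) ^+ (N * l.+1))); last first.
    by apply: lerXn2r => //; rewrite nnegrE ?mulr_ge0 ?(ltW r_gt0) // /r2 /r; lra.
  rewrite exprMn mulrC ler_pM2l ?exprn_gt0 // exprM.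
  apply: (@le_trans _ _ (2 ^+ l.+1)); last first.
    by apply: lerXn2r; rewrite ?nnegrE // (le_trans _ double).
  by rewrite -natrX ler_nat expnS mul2n -addnn leq_add // ltnW.
have ex : exists k, (n + n)%N%:R * r ^+ k <= r2 ^+ k by exists (N * l.+1)%N.
case: (ex_minnP ex) => K K_ge K_min; exists K; split=> //.
  by move=> j j_lt; rewrite ltNge; apply: contraL j_lt => /K_min; rewrite -leqNgt.
have KN : (K.+1 <= (N * l.+1).+1)%N by rewrite ltnS K_min.
apply: (@le_trans _ _ (N * l.+1).+1%:R); first by rewrite ler_nat.
(* Rounding gives N <= 17/eps + 1 <= 18/eps, and l + 1 <= 2l, so N (l + 1) <= 36 l / eps; the extra
   1 is at most l / eps, whence 37. *)
have N_le18 : N%:R <= 18 / eps.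
  rewrite /N -[_.+1]addn1 natrD (_ : 18 / eps = 17 / eps + eps^-1); last by field; rewrite gt_eqF.
  by rewrite lerD // invf_ge1 // ltW.
have l1 : 1 <= l%:R :> R by rewrite ler1n.
have el : 1 <= l%:R / eps by rewrite ler_pdivlMr // mul1r; lra.
rewrite -[(_ * _).+1]addn1 natrD natrM -[l.+1]addn1 natrD.
have : N%:R * (l%:R + 1) <= 18 / eps * (2 * l%:R) by apply: ler_pM => //; lra.
rewrite (_ : 18 / eps * (2 * l%:R) = 36 * (l%:R / eps))
  1?(_ : 37 * l%:R / eps = 37 * (l%:R / eps)); [lra|ring|ring].
Qed.

Lemma size_supp (R : realType) (n : nat) (S : 'M[R]_n) :
  size (supp S) = #|[set p : 'I_n * 'I_n | S p.1 p.2 != 0]|.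
Proof.
rewrite cardE; apply: perm_size; apply: uniq_perm; last 1 first.
  by move=> p; rewrite mem_filter !mem_enum !inE andbT.
- exact: filter_uniq (enum_uniq _).
exact: enum_uniq.
Qed.

(** The equation for gamma makes the error factor 10 (L + 1) gamma of [universal_sparsifier], with L
    = [(trunc_log 2 n).+1], equal to eps / 4. *)
Definition universal_sampling (R : realType) (n : nat) (eps : R) (S : 'M[R]_n) : Prop :=
  exists gamma : R,
    [/\ S^T = S, forall i j, 0 <= S i j,
        0 < gamma /\ 10 * (trunc_log 2 n).+2%:R * gamma = eps / 4,
        forall (p q : 'I_n -> R) t, 0 < t ->
          `|\sum_i \sum_j p i * (S i j - 1) * q j| <=
            gamma ^+ 2 * n%:R * (t * (\sum_i p i ^+ 2) + t^-1 * \sum_i q i ^+ 2)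
      & (size (supp S))%:R <=
          n%:R * (4 * 80 ^+ 4 * (trunc_log 2 n).+1%:R ^+ 6 / eps ^+ 4)].

Lemma exists_universal_sampling (R : realType) (n : nat) (eps : R) :
    (0 < n)%N -> 0 < eps -> eps < 1 ->
  exists S : 'M[R]_n, universal_sampling eps S.
Proof.
move=> n_gt0 eps_gt0 eps_lt1; set l := (trunc_log 2 n).+1.
pose gamma := eps / (40 * l.+1%:R).
have l1_gt0 : 0 < l.+1%:R :> R by rewrite ltr0n.
have gamma_gt0 : 0 < gamma by rewrite divr_gt0 // mulr_gt0.
have gammaE : 10 * l.+1%:R * gamma = eps / 4 by rewrite /gamma; field; rewrite gt_eqF.
have gamma_lt1 : gamma < 1.
  rewrite /gamma ltr_pdivrMr ?mulr_gt0 // mul1r (lt_le_trans eps_lt1) //.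
  by rewrite -natrM ler1n.
have gamma2_lt1 : gamma ^+ 2 < 1 by rewrite expr_lt1 // ltW.
(* With delta = gamma^2 the support has order n l^2 / gamma^4; since 1 / gamma <= 80 l / eps, this
   is of order n l^6 / eps^4. *)
have [S [symS S_ge0 SE suppS]] := exists_sampling n_gt0
  (exprn_gt0 2 gamma_gt0) gamma2_lt1.
exists S, gamma; split=> //; rewrite size_supp; apply: le_trans suppS _.
rewrite -/l -exprM [X in X / _](_ : _ = n%:R * (4 * l%:R ^+ 2)); last by ring.
rewrite -mulrA ler_pM2l ?ltr0n // -[4 * 80 ^+ 4 * _]mulrA -mulrA -[leRHS]mulrA ler_pM2l //.
have l_le : l.+1%:R <= 2 * l%:R :> R.
  by rewrite -natrM ler_nat /l; lia.
have inv_le : gamma^-1 <= 80 * l%:R / eps.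
  by rewrite /gamma invf_div ler_pM2r ?invr_gt0 //; lra.
have : (gamma^-1) ^+ 4 <= (80 * l%:R / eps) ^+ 4.
  by apply: lerXn2r; rewrite ?nnegrE ?invr_ge0 ?(ltW gamma_gt0) //
    (le_trans _ inv_le) // invr_ge0 ltW.
move=> /(ler_wpM2l (sqr_ge0 (l%:R : R))); rewrite exprVn => H; apply: le_trans H _.
rewrite le_eqVlt; apply/orP; left; apply/eqP; field; rewrite gt_eqF //.
Qed.

(** * Query and time bounds in polylogarithmic form *)

Section Bounds.
Variables (R : realType) (n : nat) (eps : R).
Hypothesis n_gt0 : (0 < n)%N.
Hypothesis eps_gt0 : 0 < eps.
Hypothesis eps_lt1 : eps < 1.
Let l : R := (trunc_log 2 n).+1%:R.

(** The exponent 7 collects l^6 from the sample count and l from the number of rounds; 128 = 2^7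
    comes from l <= 2 (1 + ln n). *)
Lemma log_power_le_polylog : l ^+ 7 <= 128 * polylog 7 n eps.
Proof.
have lnV_ge0 : 0 <= ln eps^-1 by rewrite ln_ge0 // invf_ge1 // ltW.
have l_le := trunc_log_le_ln R n_gt0.
have -> : 128 * polylog 7 n eps = (2 * (1 + ln n%:R + ln eps^-1)) ^+ 7.
  by rewrite /polylog exprMn; congr (_ * _); ring.
have l_ge0 : 0 <= l by rewrite ler0n.
have le2 : l <= 2 * (1 + ln n%:R + ln eps^-1) by rewrite /l; lra.
by apply: lerXn2r; rewrite // nnegrE (le_trans l_ge0).
Qed.

Lemma query_bound (m : nat) (C : R) :
  m%:R <= n%:R * (4 * 80 ^+ 4 * l ^+ 6 / eps ^+ 4) ->
  128 * 11100 * (4 * 80 ^+ 4) <= C ->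
  m%:R <= C * (n%:R / eps ^+ 4) * polylog 7 n eps.
Proof.
move=> m_le C_ge; apply: le_trans m_le _; have l7 := log_power_le_polylog.
have l1 : 1 <= l by rewrite ler1n.
have l_ge0 : 0 <= l by rewrite ler0n.
have P_ge0 : 0 <= polylog 7 n eps by have := exprn_ge0 7 l_ge0; lra.
have -> : n%:R * (4 * 80 ^+ 4 * l ^+ 6 / eps ^+ 4) = (n%:R / eps ^+ 4) * (4 * 80 ^+ 4 * l ^+ 6).
  by field; rewrite gt_eqF.
have -> : C * (n%:R / eps ^+ 4) * polylog 7 n eps =
    (n%:R / eps ^+ 4) * (C * polylog 7 n eps) by ring.
apply: ler_wpM2l; first by rewrite divr_ge0 ?ler0n // exprn_ge0 // ltW.
have l67 : l ^+ 6 <= l ^+ 7 by rewrite ler_weXn2l.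
apply: (@le_trans _ _ ((128 * 11100 * (4 * 80 ^+ 4)) * polylog 7 n eps)); last by rewrite ler_wpM2r.
move: l67 l7 P_ge0; set x := l ^+ 6; set y := l ^+ 7; set P := polylog _ _ _; lra.
Qed.

(** The factor 11100 is 100 * 37 * 3, from the time budget, the number of rounds and n + m + 1 <= 3
    n D. *)
Lemma time_bound (m K t : nat) (C : R) :
  m%:R <= n%:R * (4 * 80 ^+ 4 * l ^+ 6 / eps ^+ 4) ->
  K.+1%:R <= 37 * l / eps ->
  (t <= 100 * (n * (K.+1 * (n + m).+1)))%N ->
  128 * 11100 * (4 * 80 ^+ 4) <= C ->
  t%:R <= C * (n%:R ^+ 2 / eps ^+ 5) * polylog 7 n eps.
Proof.
move=> m_le K_le t_le C_ge.
have l7 := log_power_le_polylog.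
have l1 : 1 <= l by rewrite ler1n.
have l_ge0 : 0 <= l by rewrite ler0n.
have n1 : 1 <= n%:R :> R by rewrite ler1n.
pose D := 4 * 80 ^+ 4 * l ^+ 6 / eps ^+ 4.
have D_ge1 : 1 <= D.
  rewrite /D ler_pdivlMr ?exprn_gt0 // mul1r.
  have : eps ^+ 4 <= 1 by rewrite exprn_ile1 // ltW.
  have : 1 <= l ^+ 6 by rewrite exprn_ege1.
  by set x := l ^+ 6; lra.
have nm_le : (n + m).+1%:R <= 3 * n%:R * D.
  rewrite -[(n + m).+1]addn1 !natrD.
  have : n%:R <= n%:R * D by rewrite ler_peMr // ler0n.
  by move: m_le; rewrite -/D; lra.
have prod_le : K.+1%:R * (n + m).+1%:R <= 37 * l / eps * (3 * n%:R * D).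
  by apply: ler_pM; rewrite ?ler0n.
have : t%:R <= 100 * (n%:R * (K.+1%:R * (n + m).+1%:R)) :> R by rewrite -!natrM ler_nat.
move=> /le_trans; apply.
apply: (@le_trans _ _ (100 * (n%:R * (37 * l / eps * (3 * n%:R * D))))).
  by rewrite ler_pM2l // ler_wpM2l ?ler0n.
have -> : 100 * (n%:R * (37 * l / eps * (3 * n%:R * D))) =
    (n%:R ^+ 2 / eps ^+ 5) * (11100 * (4 * 80 ^+ 4) * l ^+ 7).
  by rewrite /D; field; rewrite gt_eqF.
have -> : C * (n%:R ^+ 2 / eps ^+ 5) * polylog 7 n eps =
  (n%:R ^+ 2 / eps ^+ 5) * (C * polylog 7 n eps) by ring.
apply: ler_wpM2l; first by rewrite divr_ge0 ?exprn_ge0 ?ler0n // ltW.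
have P_ge0 : 0 <= polylog 7 n eps by have := exprn_ge0 7 l_ge0; lra.
apply: (@le_trans _ _ ((128 * 11100 * (4 * 80 ^+ 4)) * polylog 7 n eps)); last by rewrite ler_wpM2r.
by move: l7 P_ge0; set y := l ^+ 7; set P := polylog _ _ _; lra.
Qed.
End Bounds.

Theorem theorem14 (R : realType) :
  exists (P : com) (S : forall n : nat, R -> 'M[R]_n) (C : R) (k : nat),
  forall (n : nat) (eps : R), (0 < n)%N -> 0 < eps -> eps < 1 ->
    (size (supp (S n eps)))%:R <= C * (n%:R / eps ^+ 4) * polylog k n eps /\
    forall A : 'M[R]_n,
      A^T = A ->
      bounded_entries A ->
      0 <= (eigvals A)`_n.-1 \/
        (eigvals A)`_n.-1 <= - (eps * Num.max n%:R (nuclear_norm A)) ->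
      exists (s : state R) (q t : nat),
        [/\ exec A P (init_state eps (S n eps)) s q t,
            0 <= (eigvals A)`_n.-1 -> output s = 1%N,
            (eigvals A)`_n.-1 <= - (eps * Num.max n%:R (nuclear_norm A)) ->
              output s = 0%N,
            q%:R <= C * (n%:R / eps ^+ 4) * polylog k n eps
          & t%:R <= C * (n%:R ^+ 2 / eps ^+ 5) * polylog k n eps].
Proof.
(* Outside the admissible range of n and eps the matrix defaults to 0. The choice is made from n and
   eps alone, before A is given, so the algorithm is deterministic. *)
have ex n (eps : R) : exists S : 'M[R]_n,
    (0 < n)%N -> 0 < eps -> eps < 1 -> universal_sampling eps S.
  have [[n_gt0 eps_gt0 eps_lt1]|bad] := pselect [/\ (0 < n)%N, 0 < eps & eps < 1].
    by have [S HS] := exists_universal_sampling n_gt0 eps_gt0 eps_lt1; exists S.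
  by exists 0 => n_gt0 eps_gt0 eps_lt1; case: bad.
pose S n eps := projT1 (cid (ex n eps)).
have SP n eps := projT2 (cid (ex n eps)).
exists power_trace_test, S, (128 * 11100 * (4 * 80 ^+ 4)), 7%N.
move=> n eps n_gt0 eps_gt0 eps_lt1.
have [gamma [symS S_ge0 [gamma_gt0 gammaE] SE suppS]] := SP n eps n_gt0 eps_gt0 eps_lt1.
rewrite -/(S n eps) in symS S_ge0 SE suppS.
split=> [|A symA A_bounded _]; first exact: (query_bound n_gt0 eps_gt0 eps_lt1 suppS).
have [K [K_min K_ge K_le]] := exists_rounds n_gt0 eps_gt0 eps_lt1.
have n_le4 : (n <= 4 ^ (trunc_log 2 n).+1)%N.
  have /andP[_ n_lt] : (2 ^ trunc_log 2 n <= n < 2 ^ (trunc_log 2 n).+1)%N.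
    exact: trunc_log_bounds.
  by rewrite (leq_trans (ltnW n_lt)) // leq_exp2r.
have [psd neg] := trace_gap n_gt0 eps_gt0 eps_lt1 symA A_bounded symS S_ge0
  gamma_gt0 gammaE SE n_le4.
pose s0 := init_state eps (S n eps).
have cols_lt l : (l < size (supp (S n eps)))%N ->
    (nth 0%N [seq val p.2 | p <- supp (S n eps)] l < n)%N.
  by move=> l_lt; rewrite (nth_map (Ordinal n_gt0, Ordinal n_gt0)) ?ltn_ord.
have [|||||||||||s [q [t [E out q_le t_le]]]] := @exec_power_trace_test R n A eps
  (size (supp (S n eps))) (narr s0 0) (narr s0 1) (rarr s0 0) K cols_lt K_min K_ge
  s0 n_gt0; try by [].
have rate_gt0 : 0 < (1 + eps / 16) ^+ K by rewrite exprn_gt0 //; lra.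
rewrite trace_power_vec // in out.
exists s, q, t; split=> //.
- move=> /psd/(_ K) tr_le; rewrite out (le_lt_trans tr_le) //.
  rewrite ltr_pM2r // ltr_nat.
  by rewrite -{1}[n]addn0 ltn_add2l.
- by move=> /neg/(_ K) tr_ge; rewrite out ltNge (le_trans K_ge tr_ge).
- apply: (query_bound n_gt0 eps_gt0 eps_lt1) => //.
  by apply: le_trans suppS; rewrite ler_nat.
exact: (time_bound n_gt0 eps_gt0 eps_lt1 suppS K_le t_le).
Qed.
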